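(* $\mathrm{col}_g(\mathcal{P}_k) = 5$ for $k = 7, 8$.
   Context: Graphs are finite and simple. The girth of a graph is the length of its shortest cycle (infinite if the graph has no cycle). The marking game on a graph $G$ is played by two players, Alice and Bob, with Alice playing first. They alternately mark an unmarked vertex of $G$ until all vertices are marked. For each vertex $v$, let $b(v)$ be the number of neighbors of $v$ that are marked before $v$ is marked. The game coloring number of $G$, denoted $\mathrm{col}_g(G)$, is the least $s$ such that Alice has a strategy guaranteeing that, whatever Bob plays, $b(v)+1 \leq s$ for every vertex $v$ of $G$. For a family of graphs $\mathcal{H}$, define $\mathrm{col}_g(\mathcal{H}) := \max\{\mathrm{col}_g(G) : G \in \mathcal{H}\}$. The family $\mathcal{P}_k$ is the family of planar graphs of girth at least $k$. *)

(* Defs.v *)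
From HB Require Import structures.
From mathcomp Require Import all_boot all_order all_algebra.
From mathcomp Require Import boolp classical_sets reals.

Set Implicit Arguments.
Unset Strict Implicit.
Unset Printing Implicit Defensive.

Import Order.TTheory GRing.Theory Num.Theory.

Record sgraph := SGraph {
  vertex :> finType;
  adj : rel vertex;
  adj_sym : symmetric adj;
  adj_irrefl : irreflexive adj }.

(* A cycle is listed without repeating its first vertex, so that its length is
   the size of the list.  An acyclic graph satisfies girth_geq for every k,
   in accordance with its girth being infinite. *)
Definition graph_cycle (G : sgraph) (c : seq G) : Prop :=
  [/\ 3 <= size c, uniq c & cycle (@adj G) c].

Definition girth_geq (G : sgraph) (k : nat) : Prop :=
  forall c : seq G, graph_cycle c -> k <= size c.

Section Planarity.
Local Open Scope ring_scope.
Local Open Scope classical_set_scope.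
Variable R : realType.

Definition segment (x y : 'rV[R]_2) : set 'rV[R]_2 :=
  [set p | exists t : R, 0 <= t <= 1 /\ p = (1 - t) *: x + t *: y].

(* The union of the segments joining consecutive points of x :: s. *)
Fixpoint polyline (x : 'rV[R]_2) (s : seq 'rV[R]_2) : set 'rV[R]_2 :=
  if s is y :: s' then segment x y `|` polyline y s' else [set x].

(* No self-intersection: each segment is nondegenerate and meets the rest of
   the polyline that follows it exactly in their common endpoint. *)
Fixpoint simple_polyline (x : 'rV[R]_2) (s : seq 'rV[R]_2) : Prop :=
  if s is y :: s' then
    [/\ x <> y, segment x y `&` polyline y s' = [set y]
      & simple_polyline y s']
  else True.

Definition polygonal_arc (x y : 'rV[R]_2) (A : set 'rV[R]_2) : Prop :=
  exists s : seq 'rV[R]_2,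
    [/\ simple_polyline x s, last x s = y & A = polyline x s].

(* A crossing-free drawing in R^2, with edges drawn as polygonal arcs (the
   convention of the textbooks of Diestel and of West).  The arc of an edge uv
   is arc u v = arc v u, and its interior is arc u v minus its two ends; the
   values of arc on non-edges are irrelevant. *)
Record plane_drawing (G : sgraph) (pos : G -> 'rV[R]_2)
    (arc : G -> G -> set 'rV[R]_2) : Prop := PlaneDrawing {
  pos_inj : injective pos;
  arc_sym : forall u v, adj u v -> arc u v = arc v u;
  arc_polygonal : forall u v, adj u v ->
    polygonal_arc (pos u) (pos v) (arc u v);
  arc_vertex : forall u v w, adj u v ->
    ~ (arc u v `\` [set pos u; pos v]) (pos w);
  arc_disjoint : forall u v u' v', adj u v -> adj u' v' ->
    [set u; v]%SET <> [set u'; v']%SET ->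
    (arc u v `\` [set pos u; pos v]) `&` arc u' v' = set0 }.

Definition planar (G : sgraph) : Prop :=
  exists pos arc, @plane_drawing G pos arc.

Definition planar_girth (k : nat) (G : sgraph) : Prop :=
  planar G /\ girth_geq G k.

End Planarity.

Section MarkingGame.
Variable G : sgraph.

(* A position is the duplicate-free list of the marked vertices, in marking
   order; Alice is to move when its length is even.  Strategies are
   option-valued only so that one exists on the graph without vertices. *)
Definition alice_strategy (sigma : seq G -> option G) : Prop :=
  forall h : seq G, uniq h -> ~~ odd (size h) -> size h < #|G| ->
    exists2 v, v \notin h & sigma h = Some v.

Definition play (p : seq G) : Prop := uniq p /\ size p = #|G|.

Definition follows (sigma : seq G -> option G) (p : seq G) : Prop :=
  forall i, i < size p -> ~~ odd i -> onth p i = sigma (take i p).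

Definition back_degree (p : seq G) (v : G) : nat :=
  #|[set u : G | adj v u & index u p < index v p]|.

Definition alice_guarantees (s : nat) : Prop :=
  exists2 sigma, alice_strategy sigma &
    forall p, play p -> follows sigma p ->
    forall v, back_degree p v + 1 <= s.

Lemma alice_guarantees_ex : exists s, `[< alice_guarantees s >].
Proof.
exists (#|G| + 1); apply/asboolP.
exists (fun h => [pick v | v \notin h]); last first.
  by move=> p _ _ v; rewrite leq_add2r max_card.
move=> h Uh _ hG; case: pickP => [v vh|h0]; first by exists v.
move: hG; rewrite -(card_uniqP Uh) ltnNge => /negP[].
by apply/subset_leq_card/fintype.subsetP => v _; rewrite -[_ \in _]negbK h0.
Qed.

Definition col_g : nat := ex_minn alice_guarantees_ex.

End MarkingGame.

(* m is the maximum of col_g over the family H; in particular it exists. *)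
Definition max_col_g (H : sgraph -> Prop) (m : nat) : Prop :=
  (exists2 G, H G & col_g G = m) /\ (forall G, H G -> col_g G <= m).

(* Main.v *)
(* Upper bound.  Every set S of vertices of a planar graph of girth 7 spans at
   most 3|S|/2 edges.  If each edge hands two units to its ends, these can then
   be distributed so that no vertex gets more than three of them.  Call w the
   parent of v when v gets both units of the edge vw; every vertex has at most
   one parent.  When Bob marks a vertex, Alice walks along parents, activating
   vertices, until she reaches an active vertex or one without an unmarked
   parent, and marks it.  An unmarked vertex then has at most one active child,
   so that at most four of its neighbours are marked before it.

   The edge bound replaces Euler's formula by algebra over F_2.  Draw the edges
   as arcs made of nonvertical segments.  The functional on the cycle space that
   counts modulo 2 the edges of a cycle above a point takes two values along the
   sides of an edge, which differ by the coordinate of this edge.  Hence these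
   values span the dual of the cycle space, and there are at least |E| - |V| of
   them.  The edges having a given value on exactly one side form an even edge
   set, hence contain a cycle, and each edge is counted for at most two values.

   Lower bound.  Subdivide 18 edges of the dodecahedron so that all faces become
   octagons, and attach three pendant vertices to each of the 38 vertices.  When
   three neighbours of a vertex are marked, Alice has to mark it, and this brings
   all its neighbours closer to danger.  A potential shows that Bob can force two
   such threats at a time. *)

Require Import Defs.
From Stdlib Require Import BinInt.
From mathcomp Require Import all_boot all_order all_algebra.
From mathcomp Require Import boolp classical_sets reals.
From mathcomp Require Import fintype finset bigop ring lra zify ssrZ.

Set Implicit Arguments.
Unset Strict Implicit.
Unset Printing Implicit Defensive.

Import Order.TTheory GRing.Theory Num.Theory.

Local Open Scope ring_scope.

(** * Noncrossing segments and the sums over the segments above a point *)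

Lemma affine_nonzero_sign (R : realFieldType) (a b x y : R) :
  (forall z, x <= z <= y \/ y <= z <= x -> a * z + b != 0) ->
  (0 < a * x + b) = (0 < a * y + b).
Proof.
have H u v : (forall z, u <= z <= v \/ v <= z <= u -> a * z + b != 0) ->
  0 < a * u + b -> 0 < a * v + b.
  move=> nz gu; rewrite lt0r nz /=; last by case: (leP u v) => uv; [left|right];
    rewrite lexx ?uv // ltW.
  rewrite leNgt; apply/negP => gv.
  set d := (a * u + b) - (a * v + b).
  have d0 : 0 < d by rewrite /d; lra.
  (* The zero lies at the fraction [k] of the way from [u] to [v]. *)
  pose k := (a * u + b) / d.
  have k0 : 0 <= k by rewrite divr_ge0 // ltW.
  have k1 : k <= 1 by rewrite ler_pdivrMr // mul1r /d; lra.
  have kd : k * d = a * u + b by rewrite /k mulfVK // gt_eqF.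
  have := nz (u + k * (v - u)).
  case/(_ _)/eqP; last by rewrite /d in kd; lra.
  by case: (leP u v) => uv; [left | right]; apply/andP; split; nra.
move=> nz; apply/idP/idP; apply: H => // z [] zz; apply: nz; by [left|right].
Qed.

Section SegmentSystem.
Variables (R : realFieldType) (I : finType) (Z : zmodType).
Hypothesis Z2 : forall z : Z, z + z = 0.
Variables (l r s t : I -> R) (B : I -> Z).
Let f i x := s i * x + t i.
Hypothesis lr : forall i, l i < r i.
Hypothesis noncrossing : forall i j x, i != j ->
  l i < x < r i -> l j <= x <= r j -> f i x != f j x.
Let at_ p i := (l i == p) || (r i == p).
(** Endpoints are determined by their abscissae; the shear of [generic_shear] will ensure this. *)
Hypothesis common_end : forall i j p, at_ p i -> at_ p j -> f i p = f j p.
Hypothesis even_at : forall p, \sum_(i | at_ p i) B i = 0.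

(** Middle of the common range. Comparing heights there decides which segment is above, even if the
    two share an endpoint. *)
Let mid i j := (Num.max (l i) (l j) + Num.min (r i) (r j)) / 2.
Let above j i := f i (mid i j) < f j (mid i j).
Let overlap i j := (l i < r j) && (l j < r i).

Let mid_in i j : overlap i j ->
  [/\ l i < mid i j, mid i j < r i, l j < mid i j & mid i j < r j].
Proof.
case/andP=> h1 h2; have := lr i; have := lr j; rewrite /mid.
by case: (leP (l i) (l j)); case: (leP (r i) (r j)); split; lra.
Qed.

(** Every point between [x] and [mid i j] is interior to one of the two segments, where the affine
    difference of heights cannot vanish, so its sign is constant. *)
Let aboveE i j x : i != j -> overlap i j -> l i <= x <= r i ->
  l j <= x <= r j -> (l i < x < r i) || (l j < x < r j) ->
  above j i = (f i x < f j x).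
Proof.
move=> ij ov xi xj xo; have [m1 m2 m3 m4] := mid_in ov.
rewrite /above -subr_gt0 -[RHS]subr_gt0.
have E y : f j y - f i y = (s j - s i) * y + (t j - t i) by rewrite /f; ring.
rewrite !E; apply: affine_nonzero_sign => z zz; rewrite -E subr_eq0.
have zi : l i <= z <= r i by case: zz => /andP[]; lra.
have zj : l j <= z <= r j by case: zz => /andP[]; lra.
have [zo|zo] : l i < z < r i \/ l j < z < r j.
  by case/orP: xo => /andP[? ?]; [left|right]; case: zz => /andP[? ?]; lra.
- by rewrite eq_sym noncrossing.
- by rewrite noncrossing // eq_sym.
Qed.

Let above_left i j : l i = l j -> above j i = (s i < s j).
Proof.
move=> e; have ov : overlap i j by rewrite /overlap e lr -e lr.
have [m1 m2 m3 m4] := mid_in ov.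
have h : f i (l i) = f j (l i) by apply: common_end; rewrite /at_ ?e eqxx.
rewrite /above /f in h *; set m := mid i j in m1 m2 m3 m4 *.
by apply/idP/idP => H; nra.
Qed.

Let above_right i j : r i = r j -> above j i = (s j < s i).
Proof.
move=> e; have ov : overlap i j by rewrite /overlap -e lr e lr.
have [m1 m2 m3 m4] := mid_in ov.
have h : f i (r i) = f j (r i) by apply: common_end; rewrite /at_ ?e eqxx orbT.
rewrite /above /f in h *; set m := mid i j in m1 m2 m3 m4 *.
by apply/idP/idP => H; nra.
Qed.

Let slope_inj i j : i != j -> (l i == l j) || (r i == r j) -> s i != s j.
Proof.
move=> ij E; apply/eqP => sE.
have ov : overlap i j.
  rewrite /overlap; case/orP: E => /eqP e; first by rewrite e lr -e lr.
  by rewrite -e lr e lr.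
have [m1 m2 m3 m4] := mid_in ov.
have : f i (mid i j) != f j (mid i j).
  by apply: noncrossing => //; [rewrite m1 | rewrite !ltW].
have [p [pi pj]] : exists p, at_ p i /\ at_ p j.
  by case/orP: E => /eqP e; [exists (l i) | exists (r i)]; rewrite /at_ ?e eqxx ?orbT.
have := common_end pi pj; rewrite /f sE => /addrI ->.
by rewrite eqxx.
Qed.

(* Both sums run over the segments above [i], [up] near the left end of [i] and
   [up'] near its right end; they differ by the sums of [B] around the endpoints
   lying strictly above [i]. *)
Let up i := \sum_(j | [&& j != i, l j <= l i < r j & above j i]) B j.
Let up' i := \sum_(j | [&& j != i, l j < r i <= r j & above j i]) B j.

(** Group the segments by the abscissa of the endpoint counted. By [common_end] the test depends on
    that abscissa only, so each group is either absent or sums to zero by [even_at]. *)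
Let sum_strip (i : I) :
  \sum_(j | (l i < l j < r i) && (f i (l j) < f j (l j))) B j +
  \sum_(j | (l i < r j < r i) && (f i (r j) < f j (r j))) B j = 0.
Proof.
pose G p j := if (l i < p < r i) && (f i p < f j p) then B j else 0.
pose pts := undup ([seq l j | j <- enum I] ++ [seq r j | j <- enum I]).
have lp j : l j \in pts by rewrite mem_undup mem_cat map_f ?mem_enum.
have rp j : r j \in pts by rewrite mem_undup mem_cat map_f ?orbT ?mem_enum.
have sumG (e : I -> R) : (forall j, e j \in pts) ->
    \sum_j G (e j) j = \sum_(p <- pts) \sum_(j | e j == p) G p j.
  move=> ep; under [RHS]eq_bigr => p _ do rewrite big_mkcond.
  rewrite exchange_big; apply: eq_bigr => j _.
  rewrite (bigD1_seq (e j)) ?undup_uniq ?ep //= eqxx big1 ?addr0 // => p pj.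
  by rewrite eq_sym (negPf pj).
rewrite big_mkcond [X in _ + X]big_mkcond.
rewrite -[X in X + _]/(\sum_j G (l j) j) -[X in _ + X]/(\sum_j G (r j) j).
rewrite !sumG // -big_split /=; apply: big1 => p _.
have -> : \sum_(j | l j == p) G p j + \sum_(j | r j == p) G p j =
          \sum_(j | at_ p j) G p j.
  rewrite [RHS](bigID (fun j => l j == p)) /=; congr (_ + _); apply: eq_bigl => j.
    by rewrite /at_ andbC; case: eqP.
  by rewrite /at_ andbC; case: (l j =P p) => [<-|] //=; rewrite gt_eqF.
case: (pickP (at_ p)) => [j0 pj0|no]; last by rewrite big_pred0.
rewrite -[RHS](_ : (if (l i < p < r i) && (f i p < f j0 p) then \sum_(j | at_ p j) B j else 0)
  = 0); last first.
  by rewrite even_at if_same.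
case: ifP => c; [apply: eq_bigr | apply: big1] => j pj;
  by rewrite /G (common_end pj pj0) c.
Qed.

Let up_const i : up i = up' i.
Proof.
(* As [z + z = 0], the equality amounts to the vanishing of [up i + up' i]. *)
apply/eqP; rewrite -subr_eq0 -[- _]addr0 -[X in - _ + X](Z2 (up' i)) addKr; apply/eqP.
pose P j := [&& j != i, overlap i j & above j i].
have upE : up i = \sum_(j | P j) (if l j <= l i then B j else 0).
  rewrite -big_mkcondr; apply: eq_bigl => j; rewrite /P /overlap.
  have := lr i; case: (j != i) => //=; case: (above j i); rewrite ?andbF //= !andbT.
  by move=> ?; apply/idP/idP => *; lra.
have upE' : up' i = \sum_(j | P j) (if r i <= r j then B j else 0).
  rewrite -big_mkcondr; apply: eq_bigl => j; rewrite /P /overlap.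
  have := lr i; case: (j != i) => //=; case: (above j i); rewrite ?andbF //= !andbT.
  by move=> ?; apply/idP/idP => *; lra.
(* Complement both conditions: the two full sums over [P] cancel, and the segments with an endpoint
   strictly inside the range of [i] remain. *)
have half (c : bool) z : (if c then z else 0) = z + (if ~~ c then z else 0) :> Z.
  by case: c; rewrite ?addr0 ?Z2.
rewrite upE upE' -big_split /=.
under eq_bigr => j _ do rewrite (half (l j <= l i)) (half (r i <= r j)) addrACA Z2 add0r.
rewrite big_split /= -!big_mkcondr -[RHS](sum_strip i); congr (_ + _); apply: eq_bigl => j.
  rewrite -ltNge /P; apply/idP/idP.
    case/andP=> /and3P[ji ov ab] lij; have := ov => /andP[? ?].
    by rewrite -aboveE ?ab ?andbT ?lij //= 1?eq_sym ?lexx ?(ltW (lr _)) ?ltW //; lra.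
  case/andP=> /andP[h1 h2] ab.
  have ji : j != i by apply: contraTneq h1 => ->; rewrite ltxx.
  have ov : overlap i j by rewrite /overlap h2 (lt_trans h1) .
  rewrite ji ov h1 andbT /= (@aboveE i j (l j)) // 1?eq_sym // ?h1 ?h2 ?lexx //=.
  - by rewrite !ltW.
  - by rewrite ltW.
rewrite -ltNge /P; apply/idP/idP.
  case/andP=> /and3P[ji ov ab] lij; have := ov => /andP[? ?].
  by rewrite -aboveE ?ab ?andbT ?lij //= 1?eq_sym ?lexx ?(ltW (lr _)) ?ltW //; lra.
case/andP=> /andP[h1 h2] ab.
have ji : j != i by apply: contraTneq h2 => ->; rewrite ltxx.
have ov : overlap i j by rewrite /overlap h1 (lt_trans _ h2) .
rewrite ji ov h2 andbT /= (@aboveE i j (r j)) // 1?eq_sym // ?h1 ?h2 ?lexx //=.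
- by rewrite !ltW.
- by rewrite ltW.
Qed.

(** The segments of [A] are piled up by the key [k]; [U i] is the value just above [i], and
    [U i + B i] the value just below. From top to bottom the values run from [W] to [W] plus all of
    [B], and one counts how often being [phi] changes. The induction removes the lowest segment. *)
Let stack_parity (k : I -> R) (W phi : Z) (U : I -> Z) (A : {set I}) :
  {in A &, injective k} ->
  (forall i, i \in A -> U i = W + \sum_(j in A | k i < k j) B j) ->
  odd #|[set i in A | (U i == phi) != (U i + B i == phi)]| =
  (W == phi) (+) (W + \sum_(j in A) B j == phi).
Proof.
elim: {A}_.+1 {-2}A (ltnSn #|A|) => // n IHn A An kI UE.
have [->|[i0 i0A]] := set_0Vmem A.
  rewrite big_set0 addr0 addbb (_ : [set i in set0 | _] = set0) ?cards0 //.
  by apply/setP=> i; rewrite !inE.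
pose m := [arg min_(i < i0 in A) k i]%O.
have [mA mmin] : m \in A /\ forall j, j \in A -> k m <= k j.
  by rewrite /m; case: arg_minP.
have Am : \sum_(j in A) B j = B m + \sum_(j in A :\ m) B j by rewrite (big_setD1 m).
have Um : U m = W + \sum_(j in A :\ m) B j.
  rewrite UE //; congr (_ + _); apply: eq_bigl => j; rewrite !inE andbC.
  case: (boolP (j \in A)) => jA; rewrite ?andbF // !andbT lt_neqAle mmin // andbT.
  by rewrite (inj_in_eq kI) // eq_sym.
have IH : odd #|[set i in A :\ m | (U i == phi) != (U i + B i == phi)]| =
    (W == phi) (+) (W + \sum_(j in A :\ m) B j == phi).
  apply: IHn => [|x y /setD1P[_ xA] /setD1P[_ yA]|i /setD1P[im iA]].
  - by rewrite (cardsD1 m A) mA in An.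
  - exact: kI.
  - rewrite UE //; congr (_ + _); apply: eq_bigl => j.
    by rewrite !inE; case: eqP => [->|//]; rewrite ltNge mmin //= andbF.
rewrite (cardsD1 m) oddD.
have -> : [set i in A | (U i == phi) != (U i + B i == phi)] :\ m =
          [set i in A :\ m | (U i == phi) != (U i + B i == phi)].
  by apply/setP=> i; rewrite !inE andbA.
rewrite IH inE mA /= oddb Am Um -!addrA [B m + _]addrC.
by case: (W == phi); case: (W + _ == phi); case: (W + _ == phi).
Qed.

(** Turn once around the endpoint at [p]. The segments to its right and those to its left form two
    stacks with the same top value, and with the same bottom value because [B] sums to zero around
    the endpoint; hence their parities agree. *)
Lemma segment_side_parity : exists up : I -> Z, forall phi p,
  ~~ odd #|[set i | at_ p i && ((up i == phi) != (up i + B i == phi))]|.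
Proof.
exists up => phi p.
pose L := [set i | l i == p]; pose Q := [set i | r i == p].
pose D (A : {set I}) := [set i in A | (up i == phi) != (up i + B i == phi)].
case: (pickP (at_ p)) => [i0 pi0|no]; last first.
  rewrite (_ : [set _ | _] = set0) ?cards0 //; apply/setP=> i.
  by rewrite !inE no.
pose y := f i0 p.
(* The sum over the segments passing strictly over the endpoint: the top value of both stacks. *)
pose W := \sum_(j | (l j < p < r j) && (y < f j p)) B j.
have yE i : at_ p i -> f i p = y by move=> pi; apply: common_end.
have upL i : i \in L -> up i = W + \sum_(j in L | s i < s j) B j.
  rewrite inE => /eqP li; have pi : at_ p i by rewrite /at_ li eqxx.
  have key j : l j < p -> p < r j -> above j i = (y < f j p).
    move=> j1 j2; rewrite -(yE i pi); apply: aboveE.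
    - by apply: contraTneq j1 => <-; rewrite li ltxx.
    - by rewrite /overlap li j2 (lt_trans j1) // -li lr.
    - by rewrite li lexx -li ltW.
    - by rewrite !ltW.
    - by rewrite j1 j2 orbT.
  rewrite /up (bigID (fun j => l j == p)) /= addrC; congr (_ + _); apply: eq_bigl => j.
    rewrite li; apply/idP/idP.
      case/andP=> /and3P[ji /andP[j1 j2] ab] jp.
      have j3 : l j < p by rewrite lt_neqAle jp.
      by rewrite j3 j2 /= -key.
    case/andP=> /andP[j1 j2] ab.
    have ji : j != i by apply: contraTneq j1 => ->; rewrite li ltxx.
    by rewrite ji (ltW j1) j2 (lt_eqF j1) /= andbT key.
  rewrite inE li; case: (eqVneq (l j) p) => jp; rewrite ?andbF // andbT.
  rewrite jp lexx /= -{1}jp lr /= above_left ?li ?jp //.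
  by case: eqP => //= ->; rewrite ltxx.
have upQ i : i \in Q -> up i = W + \sum_(j in Q | s j < s i) B j.
  rewrite inE => /eqP ri; have pi : at_ p i by rewrite /at_ ri eqxx orbT.
  have key j : l j < p -> p < r j -> above j i = (y < f j p).
    move=> j1 j2; rewrite -(yE i pi); apply: aboveE.
    - by apply: contraTneq j2 => <-; rewrite ri ltxx.
    - by rewrite /overlap ri j1 (lt_trans _ j2) // -ri lr.
    - by rewrite ri lexx andbT -ri ltW.
    - by rewrite !ltW.
    - by rewrite j1 j2 orbT.
  (* The segments of [Q] end at [p], so their value is read near the right end. *)
  rewrite up_const /up' (bigID (fun j => r j == p)) /= addrC; congr (_ + _); apply: eq_bigl => j.
    rewrite ri; apply/idP/idP.
      case/andP=> /and3P[ji /andP[j1 j2] ab] jp.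
      have j3 : p < r j by rewrite lt_neqAle eq_sym jp.
      by rewrite j3 j1 /= -key.
    case/andP=> /andP[j1 j2] ab.
    have ji : j != i by apply: contraTneq j2 => ->; rewrite ri ltxx.
    by rewrite ji (ltW j2) j1 (gt_eqF j2) /= andbT key.
  rewrite inE ri; case: (eqVneq (r j) p) => jp; rewrite ?andbF // andbT.
  rewrite jp lexx /= -{1}jp lr /= above_right ?ri ?jp //.
  by case: eqP => //= ->; rewrite ltxx.
have sL : {in L &, injective s}.
  move=> i j; rewrite !inE => /eqP ip /eqP jp; apply: contra_eq => ij.
  by apply: slope_inj => //; rewrite ip jp eqxx.
(* To the left of a common right end the steeper segment is the lower one, hence the key [- s i]. *)
have sQ : {in Q &, injective (fun i => - s i)}.
  move=> i j; rewrite !inE => /eqP ip /eqP jp; apply: contra_eq => ij.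
  by rewrite eqr_opp; apply: slope_inj => //; rewrite ip jp eqxx orbT.
have oL := stack_parity phi sL upL.
have oQ : odd #|D Q| = (W == phi) (+) (W + \sum_(j in Q) B j == phi).
  apply: (stack_parity phi sQ) => i iQ; rewrite upQ //; congr (_ + _).
  by apply: eq_bigl => j; rewrite ltrN2.
have LQ : \sum_(j in L) B j = \sum_(j in Q) B j.
  have e0 : \sum_(j in L) B j + \sum_(j in Q) B j = 0.
    rewrite -[RHS](even_at p) [RHS](bigID (fun j => l j == p)) /=.
    congr (_ + _); apply: eq_bigl => j; rewrite inE /at_ andbC.
      by case: eqP.
    by case: (l j =P p) => [<-|] //=; rewrite gt_eqF.
  by apply: (addIr (\sum_(j in Q) B j)); rewrite e0 Z2.
have -> : [set i | at_ p i && ((up i == phi) != (up i + B i == phi))] = D L :|: D Q.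
  by apply/setP=> i; rewrite !inE /at_ andb_orl.
rewrite cardsU (_ : D L :&: D Q = set0) ?cards0 ?subn0 ?oddD; last first.
  apply/setP=> i; rewrite !inE; case: eqP => //= <-.
  by rewrite (gt_eqF (lr i)) andbF.
by rewrite oL oQ LQ addbb.
Qed.
End SegmentSystem.

Local Close Scope ring_scope.

(** * Distributing the units of the edges *)

(** Induction on the size of [A]. If a proper nonempty subset is tight, match it first and then the
    rest outside its neighbourhood. Otherwise every such subset has a spare neighbour, so one point
    [a] may be matched arbitrarily. *)
Lemma hall_marriage (T U : finType) (u0 : U) (A : {set T}) (N : T -> {set U}) :
  (forall B : {set T}, B \subset A -> #|B| <= #|\bigcup_(x in B) N x|) ->
  exists f : T -> U, {in A &, injective f} /\ {in A, forall x, f x \in N x}.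
Proof.
elim: {A}_.+1 {-2}A (ltnSn #|A|) N => // n IHn A An N hN.
have [->|[a aA]] := set_0Vmem A.
  by exists (fun=> u0); split=> x; rewrite inE.
case: (boolP [exists B : {set T}, [&& B \proper A, B != set0 &
         #|\bigcup_(x in B) N x| <= #|B|]]) => [/existsP[B]|noB].
  case/and3P=> BA B0 Bt; have sBA := proper_sub BA.
  have [|f1 [i1 m1]] := IHn B _ N (fun C CB => hN C (subset_trans CB sBA)).
    by have := proper_card BA; lia.
  pose NB := \bigcup_(x in B) N x.
  have [||f2 [i2 m2]] := IHn (A :\: B) _ (fun x => N x :\: NB).
  - rewrite -subset0 in B0; have := cardsID B A; rewrite (setIidPr sBA).
    have : 0 < #|B| by rewrite card_gt0 -subset0.
    lia.
  - move=> C CA.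
    have := hN (C :|: B); rewrite subUset sBA andbT (subset_trans CA (subsetDl _ _)).
    move=> /(_ isT); rewrite bigcup_setU -/NB [#|C :|: B|]cardsU (_ : C :&: B = set0); last first.
      apply/setP=> x; rewrite !inE; apply: contraTF (CA) => /andP[xC xB].
      by apply/negP => /fintype.subsetP/(_ x xC); rewrite inE xB.
    have : \bigcup_(x in C) N x :|: NB \subset \bigcup_(x in C) (N x :\: NB) :|: NB.
      apply/fintype.subsetP => u; rewrite !inE; case: (boolP (u \in NB)); rewrite ?orbT //.
      move=> uB; rewrite !orbF => /bigcupP[x xC ux]; apply/bigcupP; exists x => //.
      by rewrite inE uB.
    move=> /subset_leq_card; rewrite cards0 subn0;
      have := leq_card_setU (\bigcup_(x in C) (N x :\: NB)) NB.
    by case=> + _; rewrite -/NB in Bt; lia.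
  exists (fun x => if x \in B then f1 x else f2 x); split=> [x y xA yA|x xA].
    have D z : z \in A -> z \notin B -> z \in A :\: B by rewrite inE => -> ->.
    case: ifPn => xB; case: ifPn => yB; [exact: i1 | | | by apply: i2; apply: D].
      move=> e; have := m2 y (D _ yA yB); rewrite -e inE => /andP[/negP[]].
      by apply/bigcupP; exists x => //; apply: m1.
    move=> e; have := m2 x (D _ xA xB); rewrite e inE => /andP[/negP[]].
    by apply/bigcupP; exists y => //; apply: m1.
  case: ifPn => xB; first exact: m1.
  have : x \in A :\: B by rewrite inE xB.
  by move/m2; rewrite inE => /andP[].
have /card_gt0P[u] : 0 < #|N a|.
  by have := hN [set a]; rewrite sub1set aA cards1 big_set1 => /(_ isT).
move=> ua; have [||f [fi fm]] := IHn (A :\ a) _ (fun x => N x :\ u).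
- by rewrite (cardsD1 a A) aA in An.
- move=> C CA; have [->|C0] := eqVneq C set0; first by rewrite cards0.
  have CpA : C \proper A by apply: sub_proper_trans CA _; rewrite properD1.
  move: noB; rewrite negb_exists => /forallP/(_ C); rewrite CpA C0 /= -ltnNge.
  have : \bigcup_(x in C) N x \subset u |: \bigcup_(x in C) (N x :\ u).
    apply/fintype.subsetP => v /bigcupP[x xC vx]; rewrite !inE; case: eqP => //= vu.
    by apply/bigcupP; exists x => //; rewrite !inE vx andbT; apply/eqP.
  move/subset_leq_card; rewrite cardsU1.
  by case: (_ \notin _) => /=; lia.
exists (fun x => if x == a then u else f x); split=> [x y xA yA|x xA].
  have D z : z \in A -> z != a -> z \in A :\ a by rewrite !inE => -> ->.
  case: eqVneq => xa; case: eqVneq => ya.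
  - by rewrite xa ya.
  - by move=> e; have := fm y (D _ yA ya); rewrite -e !inE eqxx.
  - by move=> e; have := fm x (D _ xA xa); rewrite e !inE eqxx.
  - by apply: fi; apply: D.
case: eqVneq => [->//|xa].
by have := fm x; rewrite !inE xa xA => /(_ isT)/andP[].
Qed.

Definition arcs_in (G : sgraph) (S : {set G}) : {set G * G} :=
  [set d | [&& adj d.1 d.2, d.1 \in S & d.2 \in S]].

(* The two units of an edge are its two orientations; apply Hall's theorem to
   place them in the slots [(v, 0), (v, 1), (v, 2)] of the ends of the edge. *)
Lemma unit_allocation (G : sgraph) :
  (forall S : {set G}, #|arcs_in S| <= 3 * #|S|) ->
  exists t : G -> G -> nat,
    (forall u v, adj u v -> t u v + t v u = 2) /\
    (forall u, \sum_(v | adj u v) t u v <= 3).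
Proof.
move=> sparse; case: (pickP (mem [set: G])) => [x0 _|no]; last first.
  by exists (fun _ _ => 0); split=> u; have := no u; rewrite !inE.
pose N (d : G * G) : {set G * 'I_3} := setX [set d.1; d.2] setT.
have [B BA|f [fi fm]] := @hall_marriage _ _ (x0, ord0) (arcs_in [set: G]) N.
  pose S : {set G} := [set d.1 | d in B] :|: [set d.2 | d in B].
  have -> : \bigcup_(d in B) N d = setX S setT.
    apply/setP=> -[v k]; rewrite !inE /= andbT; apply/bigcupP/orP.
      case=> d dB; rewrite !inE andbT => /orP[]/eqP; rewrite /= => ->; [left|right]; exact: imset_f.
    by case=> /imsetP[d dB e]; exists d; rewrite ?inE /= -?e ?eqxx ?orbT.
  rewrite cardsX cardsT card_ord mulnC; apply: leq_trans (sparse S).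
  apply/subset_leq_card/fintype.subsetP => d dB.
  have := fintype.subsetP BA d dB; rewrite !inE !andbT => -> /=.
  by rewrite (imset_f _ dB) (imset_f snd dB) orbT.
(* Number of orientations of the edge whose slot is at [u]. *)
pose t u v := ((f (u, v)).1 == u) + ((f (v, u)).1 == u).
exists t; split=> [u v uv|u].
  have uv' : u != v by apply: contraTneq uv => ->; rewrite adj_irrefl.
  have := fm (u, v); rewrite !inE uv !andbT => /(_ isT) h1.
  have := fm (v, u); rewrite !inE /= adj_sym uv !andbT => /(_ isT) h2.
  rewrite /t; move: h1 h2.
  by case/orP=> /eqP->; case/orP=> /eqP->; rewrite !eqxx ?(negPf uv') ?(eq_sym v u) ?(negPf uv').
pose D1 : {set G * G} := [set d | adj d.1 d.2 & (d.1 == u) && ((f d).1 == u)].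
pose D2 : {set G * G} := [set d | adj d.1 d.2 & (d.2 == u) && ((f d).1 == u)].
have -> : \sum_(v | adj u v) t u v = #|D1| + #|D2|.
  rewrite big_split /=; congr (_ + _).
    rewrite -sum1_card -big_mkcondr /=.
    rewrite (reindex_onto (fun v => (u, v)) snd) /=; last first.
      by move=> [a b]; rewrite inE /= => /and3P[_ /eqP-> _].
    by apply: eq_bigl => v; rewrite inE /= !eqxx andbT.
  rewrite -sum1_card -big_mkcondr /=.
  rewrite (reindex_onto (fun v => (v, u)) fst) /=; last first.
    by move=> [a b]; rewrite inE /= => /and3P[_ /eqP-> _].
  by apply: eq_bigl => v; rewrite inE /= !eqxx andbT adj_sym.
have dis : D1 :&: D2 = set0.
  apply/setP=> -[a b]; rewrite !inE /=;
    apply/negP => /andP[/and3P[ab /eqP e _] /and3P[_ /eqP e' _]].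
  by rewrite e e' adj_irrefl in ab.
have -> : #|D1| + #|D2| = #|D1 :|: D2| by rewrite cardsU dis cards0 subn0.
have DA d : d \in D1 :|: D2 -> (d \in arcs_in [set: G]) /\ (f d).1 = u.
  by rewrite !inE => /orP[]/and3P[-> _ /eqP->].
(* The units at [u] occupy distinct slots, of which [u] has three. *)
rewrite -(card_in_imset (f := fun d => (f d).2)) => [|d d' /DA[dA du] /DA[d'A d'u] e].
  by apply: leq_trans (max_card _) _; rewrite card_ord.
by apply: fi => //; rewrite [LHS]surjective_pairing [RHS]surjective_pairing du d'u e.
Qed.

(** * Alice's strategy *)

Definition marked_nbrs (G : sgraph) (h : seq G) (v : G) : {set G} :=
  [set u | adj v u & u \in h].

Lemma play_mem (G : sgraph) (p : seq G) (u : G) : play p -> u \in p.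
Proof.
move=> [Up sp]; have [_ ->] : (size p = size (enum G)) * (p =i enum G).
  by apply: uniq_min_size => // [x|]; rewrite ?mem_enum // sp cardE.
by rewrite mem_enum.
Qed.

Lemma back_degree_take (G : sgraph) (p : seq G) (v : G) : play p ->
  back_degree p v = #|marked_nbrs (take (index v p) p) v|.
Proof. by move=> pp; apply: eq_card => u; rewrite !inE in_take // play_mem. Qed.

(** [P] is an invariant of the positions in which Alice is to move. Since a back degree is the
    number of neighbours marked when the vertex gets its turn, it suffices that both moves of each
    round are safe and restore [P]. *)
Lemma alice_guaranteesI (G : sgraph) (s : nat) (P : seq G -> Prop) :
  P [::] ->
  (forall h, uniq h -> ~~ odd (size h) -> size h < #|G| -> P h ->
    exists y, [/\ y \notin h, #|marked_nbrs h y| < s &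
      forall w, w \notin rcons h y ->
        #|marked_nbrs (rcons h y) w| < s /\ P (rcons (rcons h y) w)]) ->
  alice_guarantees G s.
Proof.
move=> P0 PS.
pose good (h : seq G) y := [/\ y \notin h, #|marked_nbrs h y| < s &
  forall w, w \notin rcons h y ->
    #|marked_nbrs (rcons h y) w| < s /\ P (rcons (rcons h y) w)].
(* A strategy must answer in every position, so it falls back on any unmarked vertex when no good
   one exists. *)
pose sigma (h : seq G) := if [pick y | `[< good h y >]] is Some y then Some y
                else [pick v | v \notin h].
exists sigma.
  move=> h Uh _ hG; rewrite /sigma; case: pickP => [y /asboolP[yh _ _]|_].
    by exists y.
  case: pickP => [v vh|h0]; first by exists v.
  move: hG; rewrite -(card_uniqP Uh) ltnNge => /negP[].
  by apply/subset_leq_card/fintype.subsetP => v _; rewrite -[_ \in _]negbK h0.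
move=> p pp fp; have [Up sp] := pp.
pose ok j := forall v, onth p j = Some v -> #|marked_nbrs (take j p) v| < s.
have Ut n : uniq (take n p) by apply: take_uniq.
have takeS j v : onth p j = Some v -> take j.+1 p = rcons (take j p) v.
  move=> jv; have jp : j < size p by rewrite -onthTE jv.
  by rewrite (take_nth v) //; congr rcons; apply: onth_nth.
have step i : i.*2 < size p -> P (take i.*2 p) ->
    ok i.*2 /\ (i.*2.+1 < size p -> ok i.*2.+1 /\ P (take i.*2.+2 p)).
  move=> ip Pi; have st : size (take i.*2 p) = i.*2 by rewrite size_takel // ltnW.
  have [||y gy] := PS _ (Ut i.*2) _ _ Pi; rewrite ?st ?odd_double -?sp //.
  have sy : exists2 z, onth p i.*2 = Some z & good (take i.*2 p) z.
    rewrite fp ?odd_double // /sigma; case: pickP => [z /asboolP gz|/(_ y)/asboolP//].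
    by exists z.
  have [z pz [zh zs zw]] := sy; split.
    by move=> v; rewrite pz => -[<-].
  rewrite -onthTE; case pw : (onth p _) => [w|] // _.
  have := Ut i.*2.+2; rewrite (takeS _ w) // (takeS _ z) // rcons_uniq.
  case/andP=> wn _; have [ws Pw] := zw w wn; split=> //.
  by move=> v; rewrite pw => -[<-]; rewrite (takeS _ z).
have Pall i : i.*2 <= size p -> P (take i.*2 p).
  elim: i => [|i IHi]; first by rewrite take0.
  rewrite doubleS => ip; have ip' : i.*2 < size p by apply: leq_trans ip.
  by have [_ []] := step i ip' (IHi (ltnW ip')).
move=> v; rewrite back_degree_take // addn1; set j := index v p.
have jp : j < size p by rewrite index_mem play_mem.
have jv : onth p j = Some v.
  by rewrite onthE (nth_map v) // nth_index // -index_mem.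
suff : ok j by apply.
(* An odd place is Bob's move in the round that starts at the preceding even place. *)
have := odd_double_half j; case: (odd j) => /= jE.
  rewrite add1n in jE; have ji : (j./2).*2.+1 < size p by rewrite jE.
  have [_ /(_ ji) []] := step j./2 (ltnW ji) (Pall _ (ltnW (ltnW ji))).
  by rewrite jE.
rewrite add0n in jE; have ji : (j./2).*2 < size p by rewrite jE.
by have [+ _] := step j./2 ji (Pall _ (ltnW ji)); rewrite jE.
Qed.

Section Activation.
Variables (G : sgraph) (t : G -> G -> nat).
Hypothesis tE : forall u v, adj u v -> t u v + t v u = 2.
Hypothesis tS : forall u, \sum_(v | adj u v) t u v <= 3.

(* An edge both of whose units lie at [v] joins [v] to its parent. *)
Let parent (v w : G) := adj v w && (t v w == 2).

Let parent_inj v w w' : parent v w -> parent v w' -> w = w'.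
Proof.
move=> /andP[vw /eqP tw] /andP[vw' /eqP tw']; apply: contraTeq (tS v) => ww'.
by rewrite -ltnNge (bigD1 w) //= (bigD1 w') /= ?vw' 1?eq_sym // tw tw'; lia.
Qed.

Let children v := [set x | parent x v].
Let has_parent v := [exists w, parent v w].

(** A neighbour of [v] that is not a child leaves at least one unit of the joining edge at [v].
    There are at most three such units, and a parent uses up two of them. *)
Let nbrs_bound (M : {set G}) v :
  #|[set u | adj v u & u \in M]| <= #|children v :&: M| + (if has_parent v then 2 else 3).
Proof.
have sub : [set u | adj v u & u \in M] \subset
   (children v :&: M) :|: [set u | adj v u & 0 < t v u].
  apply/fintype.subsetP => u; rewrite !inE => /andP[vu ->];
    rewrite vu /= andbT /parent adj_sym vu /=.
  by have := tE vu; case: (t v u) => [|n]; rewrite ?orbT // add0n => ->.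
apply: leq_trans (subset_leq_card sub) _; apply: leq_trans (leq_card_setU _ _) _.
rewrite leq_add2l; have := tS v.
have cE : #|[set u | adj v u & 0 < t v u]| = \sum_(u | adj v u) (0 < t v u).
  rewrite -sum1_card [RHS](eq_bigr (fun u => if 0 < t v u then 1 else 0)); last by move=> u _;
    case: ifP.
  by rewrite -big_mkcondr; apply: eq_bigl => u; rewrite inE.
rewrite cE; case: ifP => [/existsP[w /andP[vw /eqP tw]]|_].
  rewrite !(bigD1 w vw) /= tw => h.
  have : \sum_(u | adj v u && (u != w)) (0 < t v u) <= \sum_(u | adj v u && (u != w)) t v u.
    by apply: leq_sum => u _; case: (t v u).
  lia.
by apply: leq_trans; apply: leq_sum => u _; case: (t v u).
Qed.

(* [A] is the set of activated vertices; [d v] is the number of activated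
   children in excess of the single one allowed to an active vertex. *)
Let activated (h : seq G) (A : {set G}) (d : pred G) :=
  [/\ {subset h <= A},
      (forall v, v \notin h -> #|children v :&: A| <= (v \in A) + d v) &
      (forall v, v \notin h -> v \in A -> has_parent v)].

Let marked_bound h A d v : activated h A d -> v \notin h ->
  #|marked_nbrs h v| <= #|children v :&: A| + (if has_parent v then 2 else 3).
Proof.
case=> hA _ _ vh; rewrite /marked_nbrs.
have := nbrs_bound [set x in h] v;
  rewrite (_ : [set u | adj v u & u \in [set x in h]] = [set u | adj v u & u \in h]);
    last by apply/setP => u; rewrite !inE.
move/leq_trans; apply; rewrite leq_add2r; apply/subset_leq_card/setIS.
by apply/fintype.subsetP => u; rewrite inE => /hA.
Qed.

Let children_add u A v :
  #|children v :&: (u |: A)| <= #|children v :&: A| + parent u v.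
Proof.
have [puv|puv] := boolP (parent u v).
  apply: leq_trans (subset_leq_card (_ : _ \subset u |: (children v :&: A))) _.
    by apply/fintype.subsetP => x; rewrite !inE; case: eqP.
  by rewrite cardsU1 addnC leq_add2l; case: (_ \notin _).
rewrite addn0; apply/subset_leq_card/fintype.subsetP => x; rewrite !inE.
by case/andP=> xv; rewrite xv; case: eqP => // xu; rewrite xu (negPf puv) in xv.
Qed.

(** The walk carries a vertex [u] that may have one active child too many. An active [u] has a
    parent, hence at most two active children and two other marked neighbours; an inactive [u] has
    at most one active child and three others. Either way [u] can be marked safely. Each step up
    activates a vertex, so the walk ends. *)
Let activate_walk h A u : activated h A (pred1 u) -> u \notin h ->
  exists y, [/\ y \notin h, #|marked_nbrs h y| < 5 &
    exists A', activated (rcons h y) A' pred0].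
Proof.
have [n] := ubnP #|~: A|; elim: n u A => // n IHn u A An act uh.
have [hA cA pA] := act; have mb := marked_bound act uh.
have cu := cA u uh; rewrite /= eqxx in cu.
case: (boolP (u \in A)) => uA.
  exists u; split=> //; first by move: mb; rewrite pA // uA in cu *; lia.
  exists A; split=> [v|v|v]; rewrite ?mem_rcons inE.
  - by case/predU1P=> [->//|/hA].
  - by case/norP=> /negPf vu /cA; rewrite /= vu.
  - by case/norP=> _; apply: pA.
rewrite (negPf uA) in cu.
case: (pickP (fun w => parent u w && (w \notin h))) => [w /andP[uw wh]|no].
  apply: (IHn w (u |: A)) => //.
    have := cardsC A; have := cardsC (u |: A); rewrite cardsU1 uA; lia.
  split=> [v /hA|v vh|v vh]; rewrite !inE; first by move->; rewrite orbT.
    apply: leq_trans (children_add u A v) _; rewrite leq_add //.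
      apply: leq_trans (cA v vh) _; rewrite /=.
      by case: eqP => [->|_]; rewrite ?(negPf uA) // addn0.
    by case: (boolP (parent u v)) => // /(parent_inj uw)->; rewrite /= eqxx.
  by case/predU1P=> [->|]; [apply/existsP; exists w | apply: pA].
exists u; split=> //; first by case: ifP mb => _; lia.
exists (u |: A); split=> [v|v|v]; rewrite ?mem_rcons !inE.
- by case/predU1P=> [->|/hA->]; rewrite ?eqxx ?orbT.
- case/norP=> vu vh; apply: leq_trans (children_add u A v) _.
  have := no v; rewrite vh andbT => ->; rewrite addn0.
  by have := cA v vh; rewrite /= (negPf vu).
- by case/norP=> vu vh; rewrite (negPf vu); apply: pA.
Qed.

Lemma alice_guarantees5_of_units : alice_guarantees G 5.
Proof.
(* At most one vertex has an active child too many: the parent of the vertex that Bob has just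
   marked. *)
pose P h := exists A, activated h A pred0 \/ exists2 u, u \notin h & activated h A (pred1 u).
apply: (@alice_guaranteesI G 5 P) => [|h Uh _ hG [A PA]].
  exists set0; left; split=> v; rewrite ?inE //.
  by rewrite setI0 cards0.
have [u uh actu] : exists2 u, u \notin h & activated h A (pred1 u).
  case: PA => // -[hA cA pA].
  (* Without such a vertex, the walk may start at any unmarked vertex. *)
  case: (pickP (fun v => v \notin h)) => [u uh|h0]; last first.
    move: hG; rewrite -(card_uniqP Uh) ltnNge => /negP[].
    by apply/subset_leq_card/fintype.subsetP => v _; rewrite -[_ \in _]negbK h0.
  exists u => //; split=> // v /cA/leq_trans; apply.
  by rewrite leq_add2l.
have [y [yh yb [B act]]] := activate_walk actu uh.
exists y; split=> // w wh; have mb := marked_bound act wh.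
have [hB cB pB] := act; have cw := cB w wh; rewrite addn0 in cw.
split.
  case: (boolP (w \in B)) => wB; first by rewrite pB // in mb; rewrite wB in cw;
    move: mb cw => /=; lia.
  by rewrite (negPf wB) in cw; case: ifP mb => _; move: cw => /=; lia.
case: (boolP (w \in B)) => wB.
  exists B; left; split=> [v|v|v]; rewrite ?mem_rcons inE.
  - by case/predU1P=> [->//|/hB].
  - by case/norP=> _ /cB.
  - by case/norP=> _; apply: pB.
exists (w |: B).
case: (pickP (fun u => parent w u && (u \notin rcons (rcons h y) w))) => [x /andP[wx xh]|no].
  right; exists x => //; split=> [v|v|v]; rewrite ?mem_rcons !inE.
  - by case/predU1P=> [->|/hB->]; rewrite ?eqxx ?orbT.
  - case/norP=> vw vh; apply: leq_trans (children_add w B v) _; rewrite leq_add //.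
      by apply: leq_trans (cB v vh) _; rewrite addn0 (negPf vw).
    by case: (boolP (parent w v)) => // /(parent_inj wx)->; rewrite /= eqxx.
  - by case/norP=> vw vh; rewrite (negPf vw); apply: pB.
left; split=> [v|v|v]; rewrite ?mem_rcons !inE.
- by case/predU1P=> [->|/hB->]; rewrite ?eqxx ?orbT.
- case/norP=> vw vh; apply: leq_trans (children_add w B v) _.
  have := no v; rewrite mem_rcons inE (negPf vw) vh andbT => ->; rewrite addn0.
  exact: cB.
- by case/norP=> vw vh; rewrite (negPf vw); apply: pB.
Qed.
End Activation.

(** * Counting edges by the sides they have *)

Definition edge (G : sgraph) : finType :=
  {d : G * G | adj d.1 d.2 && (enum_rank d.1 < enum_rank d.2)}.

Definition incident (G : sgraph) (e : edge G) (v : G) : bool :=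
  (v == (val e).1) || (v == (val e).2).

Lemma card_arcs_in (G : sgraph) : #|arcs_in [set: G]| = 2 * #|edge G|.
Proof.
pose D1 := [set d in arcs_in [set: G] | enum_rank d.1 < enum_rank d.2].
have cD1 : #|D1| = #|edge G|.
  by rewrite card_sig; apply: eq_card => d; rewrite !inE !andbT.
pose sw (d : G * G) := (d.2, d.1).
have swK : involutive sw by case.
rewrite -(cardsID [set d | enum_rank d.1 < enum_rank d.2]) mul2n -addnn -cD1.
congr (_ + _); first by apply: eq_card => d; rewrite !inE.
rewrite -(card_imset D1 (inv_inj swK)); apply: eq_card => d.
rewrite -[d in RHS]swK (mem_imset _ _ (inv_inj swK)) !inE !andbT /= adj_sym andbC.
case: (boolP (adj _ _)) => //= a; rewrite -leqNgt leq_eqVlt.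
case: eqP => //= /val_inj/enum_rank_inj e.
by rewrite e adj_irrefl in a.
Qed.

(** The first vertex of a longest path has a second neighbour, which lies on the path by maximality
    and closes a cycle. *)
Lemma cycle_of_leafless (T : finType) (a : rel T) (x0 y0 : T) :
  symmetric a -> a x0 y0 -> irreflexive a ->
  (forall x, #|[pred y | a x y]| != 1) ->
  exists c, [/\ 3 <= size c, uniq c & cycle a c].
Proof.
move=> asym axy airr deg.
pose P n := `[< exists x p, [/\ size p = n, uniq (x :: p) & path a x p] >].
have P1 : exists n, P n.
  exists 1; apply/asboolP; exists x0, [:: y0]; split=> //=; last by rewrite axy.
  by rewrite inE andbT; apply: contraTneq axy => ->; rewrite airr.
have Pb n : P n -> n <= #|T|.
  by move/asboolP=> [x [p [<- /card_uniqP Up _]]]; apply: ltnW;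
    rewrite -[_.+1]/(size (x :: p)) -Up max_card.
have [n /asboolP[x [p [sp Up pp]]] nmax] := ex_maxnP P1 Pb.
have n1 : 0 < n.
  apply: nmax; apply/asboolP; exists x0, [:: y0]; split=> //=; last by rewrite axy.
  by rewrite inE andbT; apply: contraTneq axy => ->; rewrite airr.
case: p sp Up pp => [sp|x1 p sp Up pp]; first by rewrite -sp in n1.
have ax1 : a x x1 by case/andP: pp.
have [y /andP[ay yx1]] : exists y, a x y && (y != x1).
  apply/existsP; apply: contraR (deg x); rewrite negb_exists => /forallP h.
  apply/eqP; rewrite -(card1 x1); apply: eq_card => y; rewrite !inE.
  have := h y; rewrite negb_and negbK; case: eqP => [->|] //=; by rewrite ?ax1 // orbF => _ /negPf.
have yp : y \in p.
  apply: contraT => yp; have := nmax n.+1; rewrite ltnn => /(_ _)/negP[] //.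
  apply/asboolP; exists y, [:: x, x1 & p]; split; first by rewrite /= -sp.
    rewrite cons_uniq Up andbT !inE (negPf yx1) (negPf yp) /= orbF.
    by apply: contraTneq ay => ->; rewrite airr.
  by rewrite /= asym ay.
case/splitPr: yp Up pp sp => p1 p2 Up pp _.
exists (x :: x1 :: rcons p1 y); split.
- by rewrite /= size_rcons.
- apply: subseq_uniq Up; rewrite -cat_rcons.
  by rewrite -[x :: _ :: _ ++ _]/((x :: x1 :: rcons p1 y) ++ p2) prefix_subseq.
- move: pp; rewrite /= -cat_rcons cat_path rcons_path => /and3P[-> h _] /=.
  move: h; rewrite !rcons_path last_rcons => /andP[-> ->] /=.
  by rewrite asym.
Qed.

(** The edges of [C] form a graph without vertices of degree one, which therefore has a cycle. Each
    vertex of this cycle has degree at least two in [C], and the degrees add up to twice [#|C|]. *)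
Lemma even_edge_set_girth (G : sgraph) (k : nat) (C : {set edge G}) :
  girth_geq G k -> C != set0 ->
  (forall v, ~~ odd #|[set e in C | incident e v]|) -> k <= #|C|.
Proof.
move=> girth /set0Pn[e0 e0C] even.
pose deg v := #|[set e in C | incident e v]|.
have ends (e : edge G) : #|[set v | incident e v]| = 2.
  rewrite (_ : [set v | _] = [set (val e).1; (val e).2]); last by apply/setP => v; rewrite !inE.
  by rewrite cards2; have := valP e; case: eqP => // ->; rewrite ltnn andbF.
have sum_deg : \sum_v deg v = 2 * #|C|.
  transitivity (\sum_(v : G) \sum_(e in C) incident e v).
    apply: eq_bigr => v _; rewrite /deg -sum1_card -big_mkcondr.
    by apply: eq_bigl => e; rewrite inE.
  rewrite exchange_big /= mulnC -sum_nat_const; apply: eq_bigr => e _.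
  by rewrite -(ends e) -sum1_card -big_mkcond; apply: eq_bigl => v; rewrite inE.
pose a : rel G := fun u v => [exists e in C, ((val e).1 == u) && ((val e).2 == v) || ((val e).1
  == v) && ((val e).2 == u)].
have asym : symmetric a.
  by move=> u v; apply: eq_existsb => e; rewrite orbC.
have aadj u v : a u v -> adj u v.
  case/existsP=> e /andP[_ /orP[]/andP[/eqP<- /eqP<-]]; last rewrite adj_sym;
    by have /andP[] := valP e.
have airr : irreflexive a.
  by move=> u; case auu: (a u u) => //; have := aadj _ _ auu; rewrite adj_irrefl.
have adeg v : #|[pred u | a v u]| = deg v.
  rewrite /deg; pose other (e : edge G) := if (val e).1 == v then (val e).2 else (val e).1.
  rewrite -(card_in_imset (f := other)).
    apply: eq_card => u; rewrite !inE; apply/existsP/imsetP.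
      case=> e /andP[eC h]; exists e; first rewrite inE eC /incident /=; rewrite /other.
        by case/orP: h => /andP[/eqP-> /eqP->]; rewrite eqxx ?orbT.
      case/orP: h => /andP[/eqP e1 /eqP e2]; first by rewrite e1 eqxx.
      by case: eqP e1 e2 => [->|_ -> //] <-.
    case=> e; rewrite inE => /andP[eC h] ->; exists e; rewrite eC /= /other.
    case/orP: h => /eqP->; first by rewrite !eqxx.
    by case: ifP => [/eqP e1|_]; rewrite ?eqxx ?orbT // e1 eqxx.
  move=> [[x y] xy] [[x' y'] xy']; rewrite !inE /incident /other /= => /andP[_ h] /andP[_ h'] E.
  have ne (u w : G) : adj u w && (enum_rank u < enum_rank w) -> (u == w) = false.
    by case: eqP => // ->; rewrite ltnn andbF.
  have nxy := ne _ _ xy; have nxy' := ne _ _ xy'.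
  apply: val_inj => /=; case/orP: h => /eqP hv; case/orP: h' => /eqP hv'; subst v.
  - by rewrite hv' !eqxx in E *; rewrite E.
  - rewrite eqxx hv' nxy' in E; move: xy xy'; rewrite E hv' /= => /andP[_ h1] /andP[_ h2].
    by have := ltn_trans h1 h2; rewrite ltnn.
  - rewrite hv' eqxx in E; rewrite -hv' nxy in E; move: xy xy';
    rewrite -E -hv' /= => /andP[_ h1] /andP[_ h2].
    by have := ltn_trans h1 h2; rewrite ltnn.
  - by rewrite nxy hv' nxy' in E; rewrite E hv'.
have deg1 v : deg v != 1 by have := even v; rewrite -/(deg v); case: (deg v) => [|[]].
have [||c [c3 Uc cc]] := @cycle_of_leafless G a (val e0).1 (val e0).2 asym _ airr.
- by apply/existsP; exists e0; rewrite e0C !eqxx.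
- by move=> x; rewrite adeg deg1.
have kc : k <= size c.
  by apply: girth; split=> //; apply: sub_cycle cc => u v; apply: aadj.
apply: leq_trans kc _; rewrite -(card_uniqP Uc) -(leq_pmul2l (isT : 0 < 2)) -sum_deg.
rewrite mulnC -sum_nat_const big_mkcond /=; apply: leq_sum => v _; case: ifP => // vc.
have : 0 < deg v.
  rewrite -adeg; apply/card_gt0P; exists (next c v); rewrite inE; exact: next_cycle.
by have := deg1 v; case: (deg v) => [|[]].
Qed.

Lemma edge_count_of_sides (G : sgraph) (k : nat) : girth_geq G k ->
  (forall (Z : zmodType) (B : edge G -> Z), (forall z : Z, z + z = 0)%R ->
    (forall v, \sum_(e | incident e v) B e = 0)%R ->
    exists up : edge G -> Z, forall phi v,
      ~~ odd #|[set e | incident e v & (up e == phi) != (up e + B e == phi)%R]|) ->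
  k * #|edge G| <= 2 * #|edge G| + k * #|G|.
Proof.
move=> girth sides; set n := #|edge G|; set m := #|G|.
pose M : 'M['F_2]_(n, m) := (\matrix_(i, j) (incident (enum_val i) (enum_val j : G))%:R)%R.
pose K := kermx M.
have rK : n - m <= \rank K by rewrite mxrank_ker leq_sub2l ?rank_leq_col.
(* The rows of [K] span the cycle space. [B e] lists their coordinates at [e], so it is the
   coordinate of [e] as a functional on that space. *)
pose B e := row (enum_rank e) K^T%R.
have F2 (x : 'F_2) : (x + x = 0)%R by apply/val_inj; case: x => [[|[|]]].
have Z2 (z : 'rV['F_2]_n) : (z + z = 0)%R by apply/rowP => i; rewrite !mxE F2.
have evenB v : (\sum_(e | incident e v) B e = 0)%R.
  apply/rowP => i; rewrite summxE !mxE; have := mulmx_ker M;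
    rewrite -/K => /matrixP/(_ i (enum_rank v)).
  rewrite !mxE => KM; rewrite -[RHS]KM (reindex (@enum_val (edge G) predT)) /=; last first.
    by apply: onW_bij; apply: enum_val_bij.
  rewrite big_mkcond; apply: eq_bigr => j _.
  by rewrite !mxE enum_valK enum_rankK; case: ifP => _; rewrite ?mulr1 ?mulr0.
have [up upP] := sides _ B Z2 evenB.
(* An edge with [B e = 0] has the same value on both sides; such a value alone would not make
   [C phi] nonempty. *)
pose Phi := [set phi | [exists e, (B e != 0%R) && ((phi == up e) || (phi == up e + B e)%R)]].
pose C phi := [set e | (up e == phi) != (up e + B e == phi)%R].
have neB e : B e != 0%R -> (up e + B e == up e)%R = false.
  by move=> /negPf; rewrite -{2}[up e]addr0 (inj_eq (addrI _)).
have Ck phi : phi \in Phi -> k <= #|C phi|.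
  rewrite inE => /existsP[e /andP[Be h]]; apply: (even_edge_set_girth girth).
    apply/set0Pn; exists e; rewrite inE; case/orP: h => /eqP->.
      by rewrite eqxx neB.
    by rewrite eqxx [up e == _]eq_sym neB.
  move=> v; have := upP phi v;
    rewrite (_ : [set e in C phi | incident e v] = [set e | incident e v & (up e == phi) != (up
      e + B e == phi)%R]) //.
  by apply/setP => e'; rewrite !inE andbC.
have PhiK : \rank K <= #|Phi|.
  rewrite -mxrank_tr.
  (* Each [B e] is the sum of the two side values of [e]. *)
  have sub : (K^T%R <= \sum_(phi in Phi) <<phi>>)%MS.
    apply/row_subP => i; rewrite -[i]enum_valK -/(B _); set e := enum_val i.
    have [->|Be] := eqVneq (B e) 0%R; first exact: sub0mx.
    rewrite -[B e]add0r -(Z2 (up e)) -addrA addmx_sub //.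
      by apply: (sumsmx_sup (up e)); rewrite ?genmxE // inE; apply/existsP; exists e;
        rewrite Be eqxx.
    by apply: (sumsmx_sup (up e + B e)%R); rewrite ?genmxE // inE; apply/existsP; exists e;
      rewrite Be eqxx orbT.
  apply: leq_trans (mxrankS sub) _; rewrite -sum1_card.
  elim/big_rec2: _ => [|phi a b _ h]; first by rewrite mxrank0.
  apply: leq_trans (mxrank_adds_leqif _ _) _; rewrite leq_add // genmxE.
  exact: rank_leq_row.
have sumC : \sum_(phi in Phi) #|C phi| <= 2 * n.
  under eq_bigr => phi _ do rewrite -sum1_card big_mkcond /=.
  rewrite exchange_big /= mulnC -sum_nat_const; apply: leq_sum => e _.
  rewrite -big_mkcondr sum1_card.
  apply: leq_trans (subset_leq_card (_ : _ \subset [set up e; (up e + B e)%R])) _;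
    last by rewrite cards2; case: eqP.
  apply/fintype.subsetP => phi; rewrite [phi \in [set _ | _]]inE inE => /andP[_ h].
  by rewrite !inE !(eq_sym phi); move: h; rewrite !inE; case: (up e == phi);
    case: ((up e + B e)%R == phi).
have : \sum_(phi in Phi) k <= 2 * n by apply: leq_trans sumC; apply: leq_sum.
by rewrite sum_nat_const; nia.
Qed.

(** * Polygonal arcs and a generic direction *)

Local Open Scope ring_scope.

Section Polyline.
Variable R : realType.
Implicit Types (x y q : 'rV[R]_2) (s : seq 'rV[R]_2).

Lemma mem_segment_l x y : segment x y x.
Proof. by exists 0; rewrite lexx ler01 subr0 scale1r scale0r addr0. Qed.

Lemma mem_segment_r x y : segment x y y.
Proof. by exists 1; rewrite lexx ler01 subrr scale0r scale1r add0r. Qed.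

Let piece_behead x y s k : (k < size s)%N ->
  segment (nth x [:: x, y & s] k.+1) (nth x [:: x, y & s] k.+2) =
  segment (nth y (y :: s) k) (nth y (y :: s) k.+1).
Proof. by move=> ks; congr segment; apply: set_nth_default => //; apply: ltnW. Qed.

Lemma polyline_piece x s k q : (k < size s)%N ->
  segment (nth x (x :: s) k) (nth x (x :: s) k.+1) q -> polyline x s q.
Proof.
elim: s x k => // y s IHs x [|k] /= ks; first by left.
by rewrite -/(nth x [:: x, y & s] k.+1) piece_behead // => h; right; apply: (IHs y k ks).
Qed.

Lemma polyline_last x s : polyline x s (last x s).
Proof. by elim: s x => [|y s IHs] x //=; right. Qed.

Lemma polyline_head x s : polyline x s x.
Proof. by case: s => [|y s] //=; left; apply: mem_segment_l. Qed.

Lemma polyline_mem x s q : q \in s -> polyline x s q.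
Proof.
elim: s x => // y s IHs x; rewrite inE => /predU1P[->|qs]; right; last exact: IHs.
exact: polyline_head.
Qed.

Lemma simple_polyline_uniq x s : simple_polyline x s -> uniq (x :: s).
Proof.
elim: s x => // y s IHs x [xy sep sp]; rewrite cons_uniq (IHs _ sp) andbT inE.
apply/norP; split; first exact/eqP.
apply/negP => xs; have : (segment x y `&` polyline y s)%classic x.
  by split; [apply: mem_segment_l | apply: polyline_mem].
by rewrite sep.
Qed.

Lemma simple_polyline_head x s k : simple_polyline x s -> (k < size s)%N ->
  segment (nth x (x :: s) k) (nth x (x :: s) k.+1) x -> k = 0%N.
Proof.
case: s => // y s [xy sep sp]; case: k => // k ks h.
have : (segment x y `&` polyline y s)%classic x.
  split; first exact: mem_segment_l.
  apply: (polyline_piece (k := k)) => //.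
  by rewrite -(piece_behead x).
by rewrite sep.
Qed.

Lemma simple_polyline_last x s k : simple_polyline x s -> (k < size s)%N ->
  segment (nth x (x :: s) k) (nth x (x :: s) k.+1) (last x s) -> k.+1 = size s.
Proof.
elim: s x k => // y s IHs x k spx; have [xy sep sp] := spx; case: k => [_ h|k ks h] /=.
  have : (segment x y `&` polyline y s)%classic (last y s).
    by split=> //; apply: polyline_last.
  rewrite sep => ly; have := simple_polyline_uniq sp; case: s ly {IHs sep spx sp h} => // z s /= lz.
  by rewrite -{1}lz mem_last.
by congr _.+1; apply: (IHs y) => //; rewrite -(piece_behead x).
Qed.

Lemma simple_polyline_pieces x s k m q : simple_polyline x s ->
  (k < m)%N -> (m < size s)%N ->
  segment (nth x (x :: s) k) (nth x (x :: s) k.+1) q ->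
  segment (nth x (x :: s) m) (nth x (x :: s) m.+1) q ->
  q = nth x (x :: s) k.+1 /\ m = k.+1.
Proof.
elim: s x k m => // y s IHs x k m [xy sep sp].
case: m => // m; case: k => [|k] km ms hk hm; last first.
  rewrite ltnS in km; have [||e1 e2] := IHs y k m sp km ms.
  - by rewrite -(piece_behead x) //; apply: ltn_trans km ms.
  - by rewrite -(piece_behead x).
  - split; last by rewrite e2.
    by rewrite e1; apply: set_nth_default; apply: ltn_trans km ms.
have hm' : segment (nth y (y :: s) m) (nth y (y :: s) m.+1) q by rewrite -(piece_behead x).
have qy : q = y.
  have : (segment x y `&` polyline y s)%classic q by split=> //; apply: polyline_piece hm'.
  by rewrite sep.
split=> //; congr _.+1; apply: (simple_polyline_head sp) => //.
by move: hm'; rewrite qy.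
Qed.

(** A breakpoint is an end of the piece before it and of the piece after it; only the first and the
    last point lack one of these. *)
Lemma odd_piece_ends x s q : uniq (x :: s) -> s != [::] ->
  odd #|[set k : 'I_(size s) | (nth x (x :: s) k == q) || (nth x (x :: s) k.+1 == q)]| =
  (x == q) || (last x s == q).
Proof.
move=> Us s0; set n := size s; have n0 : (0 < n)%N by rewrite lt0n size_eq0.
have ls : last x s = nth x (x :: s) n by rewrite (last_nth x).
case: (boolP (q \in x :: s)) => [qs|qs]; last first.
  rewrite (_ : [set _ | _] = set0) ?cards0.
    symmetry; apply/norP; split; apply: contraNneq qs => <-; rewrite ?mem_head //.
    exact: mem_last.
  by apply/setP => k; rewrite !inE; apply/norP; split;
    apply: contraNneq qs => <-; apply: mem_nth => /=; have := ltn_ord k; rewrite -/n ltnS //;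
      apply: ltnW.
have [j [jn jq]] : exists j, (j <= n)%N /\ nth x (x :: s) j = q.
  by exists (index q (x :: s)); rewrite nth_index // -ltnS -[n.+1]/(size (x :: s)) index_mem.
have E k : (k <= n)%N -> (nth x (x :: s) k == q) = (k == j).
  by move=> kn; rewrite -jq nth_uniq.
have -> : (x == q) = (0%N == j) by rewrite -E.
rewrite ls E //.
have -> : [set k : 'I_n | (nth x (x :: s) k == q) || (nth x (x :: s) k.+1 == q)] =
   [set k : 'I_n | (k == j :> nat) || (k.+1 == j)].
  by apply/setP => k; rewrite !inE !E // ltnW.
have -> : [set k : 'I_n | (k == j :> nat) || (k.+1 == j)] =
   [set k : 'I_n | k == j :> nat] :|: [set k : 'I_n | k.+1 == j].
  by apply/setP => k; rewrite !inE.
rewrite cardsU (_ : _ :&: _ = set0) ?cards0 ?subn0; last first.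
  by apply/setP => k; rewrite !inE; apply/negP => /andP[/eqP<-]; rewrite gtn_eqF.
have c1 : #|[set k : 'I_n | k == j :> nat]| = (j < n)%N.
  case: ltnP => h; last by apply: eq_card0 => k; rewrite !inE; have := ltn_ord k; lia.
  by apply: etrans (cards1 (Ordinal h)); apply: eq_card => k; rewrite !inE.
have c2 : #|[set k : 'I_n | k.+1 == j]| = (0 < j)%N.
  case: j jn {jq E c1} => [|j] jn; first by apply: eq_card0 => k; rewrite !inE.
  by apply: etrans (cards1 (Ordinal jn)); apply: eq_card => k; rewrite !inE.
rewrite c1 c2 oddD !oddb; move: jn n0; clear; lia.
Qed.

(** This excludes vertical pieces and distinct breakpoints on a vertical line. Two distinct points
    collide only if [c] equals the ratio attached to them, and [c] is chosen larger than all
    ratios. *)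
Lemma generic_shear (L : seq 'rV[R]_2) :
  exists c : R, {in L &, injective (fun p : 'rV[R]_2 => p 0 0 + c * p 0 1)}.
Proof.
pose ratio (d : 'rV[R]_2 * 'rV[R]_2) := (d.2 0 0 - d.1 0 0) / (d.1 0 1 - d.2 0 1).
pose bad := [seq ratio d | d <- [seq (p, q) | p <- L, q <- L]].
exists (1 + \sum_(b <- bad) `|b|) => p q pL qL /= E; apply: contraTeq isT => pq.
have h : p 0 1 - q 0 1 != 0.
  apply: contraNneq pq => e; apply/eqP/rowP => i.
  have e1 : p 0 1 = q 0 1 by apply/eqP; rewrite -subr_eq0 e.
  rewrite e1 in E; have e0 := addIr _ E.
  by case: i => [[|[|//]] hi]; [move: e0 | move: e1]; congr (_ = _); congr (_ _ _); apply: val_inj.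
have : (q 0 0 - p 0 0) / (p 0 1 - q 0 1) \in bad.
  by apply/mapP; exists (p, q) => //; apply/allpairsP; exists (p, q).
set b := _ / _ => bb.
have : `|b| <= \sum_(b <- bad) `|b|.
  rewrite (big_rem b) //= lerDl; apply: sumr_ge0 => *; exact: normr_ge0.
have : b = 1 + \sum_(b <- bad) `|b|.
  by apply: (mulIf h); rewrite /b divfK //; move: E; set S := \sum_(_ <- _) _; lra.
have := ler_norm b; lra.
Qed.
End Polyline.

Lemma eq_odd_sum (J : finType) (f g : J -> nat) :
  (forall j, odd (f j) = odd (g j)) -> odd (\sum_j f j)%N = odd (\sum_j g j)%N.
Proof.
move=> fg; apply: (big_ind2 (fun a b => odd a = odd b)) => // a b a' b' h h'.
by rewrite !oddD h h'.
Qed.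

(** * Side values of the edges of a plane drawing *)

Section DrawingSides.
Variables (R : realType) (G : sgraph) (pos : G -> 'rV[R]_2).
Variable arc : G -> G -> set 'rV[R]_2.
Hypothesis drawing : plane_drawing pos arc.
Variables (Z : zmodType) (B : edge G -> Z).
Hypothesis Z2 : forall z : Z, z + z = 0.
Hypothesis evenB : forall v, \sum_(e | incident e v) B e = 0.

(** Apply [segment_side_parity] to the pieces of all arcs. At an inner breakpoint exactly two pieces
    meet, so both or neither have [phi] on exactly one side. Where an arc turns back, its upper and
    lower sides are exchanged; hence it is this property, rather than the value [up], that is
    followed along an edge. *)
Lemma drawing_sides : exists up : edge G -> Z, forall phi v,
  ~~ odd #|[set e | incident e v & (up e == phi) != (up e + B e == phi)]|.
Proof.
pose src (e : edge G) := (val e).1; pose dst (e : edge G) := (val e).2.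
have eadj e : adj (src e) (dst e) by have /andP[] := valP e.
have [s sP] : exists s : edge G -> seq 'rV[R]_2, forall e,
    [/\ simple_polyline (pos (src e)) (s e), last (pos (src e)) (s e) = pos (dst e)
      & arc (src e) (dst e) = polyline (pos (src e)) (s e)].
  have h e : exists s, [/\ simple_polyline (pos (src e)) s, last (pos (src e)) s = pos (dst e)
      & arc (src e) (dst e) = polyline (pos (src e)) s].
    exact: (arc_polygonal drawing (eadj e)).
  by have [s sP] := boolp.choice h; exists s.
pose pt e k := nth (pos (src e)) (pos (src e) :: s e) k.
have Us e : uniq (pos (src e) :: s e) by have [/simple_polyline_uniq] := sP e.
have sd e : src e != dst e by apply: contraTneq (eadj e) => ->; rewrite adj_irrefl.
have s0 e : s e != [::].
  apply: contraNneq (sd e) => se; have [_ + _] := sP e; rewrite se => /= /(pos_inj drawing) ->.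
  by [].
have sgt e : (0 < size (s e))%N by rewrite lt0n size_eq0.
pose I : finType := {e : edge G & 'I_(size (s e))}.
pose P0 (i : I) := pt (tag i) (tagged i); pose P1 (i : I) := pt (tag i) (tagged i).+1.
have P01 i : P0 i != P1 i.
  rewrite /P0 /P1 /pt nth_uniq ?Us //= ?ltnS ?ltn_ord //; last by apply: ltnW.
  by rewrite neq_ltn leqnn.
have crossP (e e' : edge G) q : e != e' -> arc (src e) (dst e) q -> arc (src e') (dst e') q ->
    (q == pos (src e)) || (q == pos (dst e)).
  move=> ee' q1 q2; have : [set src e; dst e] <> [set src e'; dst e'].
    move=> E; case/negP: ee'; apply/eqP/val_inj.
    have /andP[_ r1] := valP e; have /andP[_ r2] := valP e'.
    rewrite [LHS]surjective_pairing [RHS]surjective_pairing -!/(src _) -!/(dst _).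
    rewrite -!/(src _) -!/(dst _) in r1 r2.
    have := set21 (src e) (dst e); have := set22 (src e) (dst e); rewrite E !inE.
    case/orP=> /eqP h1; case/orP=> /eqP h2; rewrite ?h1 ?h2 //.
    - by move: r1; rewrite h1 h2 ltnn.
    - by rewrite h1 h2 in r1; have := ltn_trans r1 r2; rewrite ltnn.
    - by move: r1; rewrite h1 h2 ltnn.
  move/(arc_disjoint drawing (eadj e) (eadj e')) => dis.
  apply: contraT => nq; have : (@classical_sets.set0 'rV[R]_2) q; last by [].
  by rewrite -dis; split=> //; split=> // -[] /= E; move: nq; rewrite E eqxx ?orbT.
(* Pieces of one arc meet only at breakpoints, by simplicity; pieces of different arcs meet only at
   ends of the arcs. *)
have endsP (i j : I) q : i != j -> segment (P0 i) (P1 i) q -> segment (P0 j) (P1 j) q ->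
    (q == P0 i) || (q == P1 i).
  have wl (e : edge G) (k m : 'I_(size (s e))) : (k < m)%N ->
      segment (pt e k) (pt e k.+1) q -> segment (pt e m) (pt e m.+1) q ->
      q = pt e k.+1 /\ q = pt e m.
    move=> km hk hm; have [sp _ _] := sP e.
    by have [->] := simple_polyline_pieces sp km (ltn_ord m) hk hm; rewrite /pt => ->.
  case: i j => [e k] [e' m]; rewrite /P0 /P1 /= => ij hk hm.
  case: (eqVneq e e') => ee'.
    move: m ij hm; rewrite -ee' => m ij hm.
    have [km|km|km] := ltngtP k m.
    - by have [<- _] := wl e k m km hk hm; rewrite eqxx orbT.
    - by have [_ <-] := wl e m k km hm hk; rewrite eqxx.
    - by case/negP: ij; apply/eqP; congr existT; apply: val_inj.
  have [sp lp ap] := sP e; have [sp' lp' ap'] := sP e'.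
  have q1 : arc (src e) (dst e) q by rewrite ap; apply: polyline_piece hk.
  have q2 : arc (src e') (dst e') q by rewrite ap'; apply: polyline_piece hm.
  case/orP: (crossP _ _ _ ee' q1 q2) => /eqP qe.
    rewrite qe in hk; have := simple_polyline_head sp (ltn_ord k) hk => k0.
    by rewrite qe /pt k0 eqxx.
  rewrite qe -lp in hk; have := simple_polyline_last sp (ltn_ord k) hk => kn.
  by rewrite qe /pt kn -lp (last_nth (pos (src e))) eqxx orbT.
pose L := flatten [seq pos (src e) :: s e | e <- enum (edge G)].
have ptL e k : (k <= size (s e))%N -> pt e k \in L.
  by move=> ks; apply/flatten_mapP; exists e; rewrite ?mem_enum // mem_nth.
have [c Xinj] := generic_shear L.
pose X (p : 'rV[R]_2) := p 0 0 + c * p 0 1; pose Y (p : 'rV[R]_2) := p 0 1.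
have XYinj p q : X p = X q -> Y p = Y q -> p = q.
  rewrite /X /Y => E e1; rewrite e1 in E; have e0 := addIr _ E; apply/rowP => i.
  by case: i => [[|[|//]] hi]; [move: e0 | move: e1]; congr (_ = _); congr (_ _ _); apply: val_inj.
have P0L i : P0 i \in L by apply: ptL; apply: ltnW.
have P1L i : P1 i \in L by apply: ptL.
have X01 i : X (P0 i) != X (P1 i).
  by apply: contraNneq (P01 i) => /Xinj; rewrite P0L P1L => /(_ isT isT)->.
pose l i := Num.min (X (P0 i)) (X (P1 i)); pose r i := Num.max (X (P0 i)) (X (P1 i)).
pose sl i := (Y (P1 i) - Y (P0 i)) / (X (P1 i) - X (P0 i)).
pose tl i := Y (P0 i) - sl i * X (P0 i).
have dX i : X (P1 i) - X (P0 i) != 0 by rewrite subr_eq0 eq_sym.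
have f0 i : sl i * X (P0 i) + tl i = Y (P0 i) by rewrite /tl; ring.
have f1 i : sl i * X (P1 i) + tl i = Y (P1 i) by rewrite /tl /sl; field.
have onseg i x : l i <= x <= r i ->
    exists q, [/\ segment (P0 i) (P1 i) q, X q = x & Y q = sl i * x + tl i].
  move=> lxr; pose tau := (x - X (P0 i)) / (X (P1 i) - X (P0 i)).
  have Xt : (1 - tau) * X (P0 i) + tau * X (P1 i) = x by rewrite /tau; field.
  exists ((1 - tau) *: P0 i + tau *: P1 i); split.
  - exists tau; split=> //; move: lxr (X01 i) Xt; rewrite /l /r; clearbody tau.
    move: (X (P0 i)) (X (P1 i)) => a b; case: (leP a b) => h /andP[h1 h2] ab xE.
      have {ab} h : a < b by rewrite lt_neqAle ab.
      by apply/andP; split; nra.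
    by apply/andP; split; nra.
  - by rewrite -[RHS]Xt /X !mxE; ring.
  - have -> : Y ((1 - tau) *: P0 i + tau *: P1 i) = (1 - tau) * Y (P0 i) + tau * Y (P1 i).
      by rewrite /Y !mxE.
    by rewrite -f0 -f1 -[in RHS]Xt; ring.
have lr i : l i < r i by rewrite /l /r; case: (leP (X (P0 i)) (X (P1 i))) => // h;
  rewrite lt_neqAle X01.
pose at_ p i := (l i == p) || (r i == p).
have atX p i : at_ p i = (X (P0 i) == p) || (X (P1 i) == p).
  by rewrite /at_ /l /r; case: (leP (X (P0 i)) (X (P1 i))) => // _; rewrite orbC.
have atL q i : q \in L -> at_ (X q) i = (P0 i == q) || (P1 i == q).
  by move=> qL; rewrite atX !(inj_in_eq Xinj).
have noncrossing i j x : i != j -> l i < x < r i -> l j <= x <= r j ->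
    sl i * x + tl i != sl j * x + tl j.
  move=> ij xi xj; apply/eqP => E.
  have [|q [qi qX qY]] := onseg i x; first by case/andP: xi => *; rewrite !ltW.
  have [q' [qj qX' qY']] := onseg j x xj.
  have qq : q' = q by apply: XYinj; [rewrite qX | rewrite qY qY' E].
  rewrite qq in qj; case/orP: (endsP _ _ _ ij qi qj) => /eqP qe; move: xi; rewrite -qX qe /l /r;
    by case: (leP (X (P0 i)) (X (P1 i))) => _; rewrite ltxx ?andbF.
have common_end i j p : at_ p i -> at_ p j -> sl i * p + tl i = sl j * p + tl j.
  have key k : at_ p k -> exists q, [/\ q \in L, X q = p & sl k * p + tl k = Y q].
    by rewrite atX => /orP[]/eqP <-; [exists (P0 k) | exists (P1 k)].
  move=> /key[q [qL qp ->]] /key[q' [qL' qp' ->]].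
  by congr Y; apply: Xinj => //; rewrite -/(X q) -/(X q') qp.
pose BI (i : I) := B (tag i).
have odd_at q (e : edge G) : odd #|[set k : 'I_(size (s e)) | (pt e k == q) || (pt e k.+1 == q)]| =
    (pos (src e) == q) || (pos (dst e) == q).
  by have [_ <- _] := sP e; apply: odd_piece_ends.
have mulB b n : b *+ n = if odd n then b else 0 :> Z.
  rewrite -{1}(odd_double_half n) mulrnDr -mul2n mulrnA mulr2n Z2 mul0rn addr0.
  by case: odd.
(* Each edge contributes [B e] once per piece ending at the point, an odd number of times exactly if
   the point is an end of the edge. This leaves [evenB] at a vertex, or an empty sum. *)
have even_at p : \sum_(i | at_ p i) BI i = 0.
  case: (pickP (at_ p)) => [i0 pi0|no]; last by rewrite big_pred0.
  have [q [qL qp]] : exists q, q \in L /\ X q = p.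
    by move: pi0; rewrite atX => /orP[]/eqP <-; [exists (P0 i0) | exists (P1 i0)].
  rewrite -qp (eq_bigl (fun i => predT (tag i) && ((pt (tag i) (tagged i : 'I_(size (s (tag
    i)))) == q) || (pt (tag i) (tagged i : 'I_(size (s (tag i)))).+1 == q)))); last first.
    by move=> i; rewrite atL.
  rewrite -(@sig_big_dep _ _ _ _ _ predT (fun e (k : 'I_(size (s e))) => (pt e k == q) || (pt e
    k.+1 == q)) (fun e _ => B e)) /=.
  have inner (e : edge G) : \sum_(k < size (s e) | (pt e k == q) || (pt e k.+1 == q)) B e =
      if (pos (src e) == q) || (pos (dst e) == q) then B e else 0.
    by rewrite sumr_const -odd_at cardsE mulB.
  rewrite (eq_bigr _ (fun e _ => inner e)).
  rewrite -big_mkcond.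
  case: (pickP (fun v => pos v == q)) => [v /eqP vq|nv]; last first.
    by rewrite big_pred0 // => e; rewrite !nv.
  rewrite -[RHS](evenB v); apply: eq_bigl => e.
  by rewrite -vq !(inj_eq (pos_inj drawing)) /incident !(eq_sym v).
have [up upP] := segment_side_parity Z2 lr noncrossing common_end even_at.
pose i0 e : I := Tagged (fun e => 'I_(size (s e))) (Ordinal (sgt e)).
pose side phi i := (up i == phi) != (up i + BI i == phi).
have side_const phi (e : edge G) k (ks : (k < size (s e))%N) :
    side phi (Tagged (fun e => 'I_(size (s e))) (Ordinal ks) : I) = side phi (i0 e).
  elim: k ks => [|k IHk] ks; first by congr (side phi (existT _ _ _)); apply: val_inj.
  rewrite -(IHk (ltnW ks)); set b : I := Tagged _ (Ordinal ks); set a : I := Tagged _ _.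
  apply/esym.
  have ab : a != b.
    by apply/eqP => /(congr1 (fun i : I => (tagged i : 'I_(size (s (tag i)))) : nat)) /= /eqP;
      rewrite ltn_eqF.
  have := upP phi (X (pt e k.+1)).
  have -> : [set i | at_ (X (pt e k.+1)) i & side phi i] = [set i in [set a; b] | side phi i].
    apply/setP => i; rewrite !inE; congr (_ && _); rewrite atL ?ptL // 1?ltnW //.
    apply/idP/idP; last first.
      by case/orP=> /eqP->; apply/orP; [right | left]; apply/eqP.
    move=> h; apply/orP; move: h.
    case: i => e' m; rewrite /P0 /P1 /= => h.
    have [ee'|ee'] := eqVneq e' e.
      move: m h; rewrite ee' => m; rewrite /pt !nth_uniq ?Us //= ?ltnS ?ltn_ord // 1?ltnW // eqSS.
      by case/orP=> /eqP mk; [right|left]; apply/eqP; congr existT; apply: val_inj.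
    have [_ _ ap] := sP e; have [_ _ ap'] := sP e'.
    have q1 : arc (src e) (dst e) (pt e k.+1).
      by rewrite ap; apply: polyline_mem; rewrite /pt /= mem_nth // ltnW.
    have q2 : arc (src e') (dst e') (pt e k.+1).
      rewrite ap'; case/orP: h => /eqP <-; apply: (@polyline_piece _ _ _ m) => //;
        [exact: mem_segment_l | exact: mem_segment_r].
    have [_ lp _] := sP e.
    (* Another arc could meet this one only at its ends, and an inner breakpoint is not an end. *)
    rewrite eq_sym in ee'; case/orP: (crossP _ _ _ ee' q1 q2).
    - by rewrite -[pos (src e)]/(pt e 0) nth_uniq ?Us //= ltnS ltnW.
    - by rewrite -lp (last_nth (pos (src e))) nth_uniq ?Us //= ?ltnS ?(ltnW ks) // ltn_eqF.
  have -> : [set i in [set a; b] | side phi i] =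
      (if side phi a then [set a] else set0) :|: (if side phi b then [set b] else set0).
    apply/setP=> i; rewrite !inE andb_orl; congr (_ || _).
      by case: eqP => [->|n] /=; case: ifP => _; rewrite inE ?eqxx //; apply/esym/eqP.
    by case: eqP => [->|n] /=; case: ifP => _; rewrite inE ?eqxx //; apply/esym/eqP.
  by case: (side phi a); case: (side phi b); rewrite ?setU0 ?set0U ?cards1.
exists (fun e => up (i0 e)) => phi v.
have [ev|ne] := pickP (fun e => incident e v); last first.
  by rewrite (_ : [set _ | _] = set0) ?cards0 //; apply/setP => e; rewrite !inE ne.
have vL : incident ev v -> pos v \in L.
  have [_ lp _] := sP ev; case/orP=> /eqP ->; first exact: (ptL ev 0%N).
  have := ptL ev (size (s ev)) (leqnn _); rewrite /pt -lp (last_nth (pos (src ev))); exact.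
move=> /vL {}vL; have := upP phi (X (pos v)).
rewrite -!sum1_card !big_mkcond /=.
have -> : (\sum_(i : I) (if i \in [set i | at_ (X (pos v)) i & side phi i] then 1 else 0) =
  \sum_(e : edge G) \sum_(k < size (s e)) (if ((pt e k == pos v) || (pt e k.+1 == pos v)) &&
    side phi (i0 e) then 1 else 0))%N.
  rewrite sig_big_dep /=; apply: eq_bigr => -[e k] _ /=; rewrite inE atL // /P0 /P1 /=.
  by rewrite -(side_const phi e k (ltn_ord k));
    congr (if _ && side phi (existT _ _ _) then _ else _); apply: val_inj.
(* Modulo 2, the pieces of [e] ending at [pos v] count once if [v] is an end of [e], and not at all
   otherwise. *)
rewrite (@eq_odd_sum _ _ (fun e => if e \in [set e | incident e v & side phi (i0 e)] then 1
  else 0)%N); [by rewrite -big_mkcond | move=> e].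
rewrite inE /incident !(eq_sym v) -!(inj_eq (pos_inj drawing)) -odd_at.
case: (side phi (i0 e)); last by rewrite andbF big1 // => k _; rewrite andbF.
under eq_bigr do rewrite andbT.
by rewrite -big_mkcond sum1_card cardsE andbT; case: (odd #|_|).
Qed.
End DrawingSides.

Local Close Scope ring_scope.

(** * Sparsity of induced subgraphs and the upper bound *)

Definition induced (G : sgraph) (S : {set G}) : sgraph :=
  @SGraph {x : G | x \in S} (fun x y => adj (val x) (val y))
    (fun x y => adj_sym (val x) (val y)) (fun x => adj_irrefl (val x)).

Lemma induced_girth (G : sgraph) (S : {set G}) (k : nat) :
  girth_geq G k -> girth_geq (induced S) k.
Proof.
move=> girth c [c3 Uc cc]; rewrite -(size_map val); apply: girth; split.
- by rewrite size_map.
- by rewrite map_inj_uniq //; apply: val_inj.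
- by case: c {c3 Uc} cc => //= x p; rewrite -map_rcons path_map.
Qed.

Lemma induced_planar (R : realType) (G : sgraph) (S : {set G}) :
  planar R G -> planar R (induced S).
Proof.
case=> pos [arc [pinj asym apoly avert adisj]].
exists (fun x => pos (val x)), (fun x y => arc (val x) (val y)); split.
- by move=> x y /pinj/val_inj.
- by move=> x y; apply: asym.
- by move=> x y; apply: apoly.
- by move=> x y z xy; apply: avert.
- move=> x y x' y' xy xy' ne; apply: adisj => // E; apply: ne.
  apply/setP => z; have := congr1 (fun A : {set G} => val z \in A) E.
  by rewrite !inE !(inj_eq val_inj).
Qed.

Lemma card_arcs_induced (G : sgraph) (S : {set G}) :
  #|arcs_in [set: induced S]| = #|arcs_in S|.
Proof.
pose h (d : induced S * induced S) := (val d.1, val d.2).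
have hi : injective h by move=> [a b] [a' b'] [/val_inj-> /val_inj->].
rewrite -(card_imset _ hi); apply: eq_card => d; apply/imsetP/idP.
  by case=> -[a b]; rewrite !inE !andbT /= => ab ->; rewrite /= ab (valP a) (valP b).
rewrite inE; case: d => x y /and3P[/= xy xS yS].
by exists (exist _ x xS, exist _ y yS) => //; rewrite !inE /= xy.
Qed.

(** Hall's condition needs the edge bound in every vertex set, hence the induced subgraphs. For
    girth 7, five times the number of edges is at most seven times the number of vertices, so there
    are at most 14/5 arcs per vertex. *)
Lemma planar_girth7_alice (R : realType) (G : sgraph) :
  planar R G -> girth_geq G 7 -> alice_guarantees G 5.
Proof.
move=> plG girth; have [S|t [tE tS]] := @unit_allocation G; last first.
  exact: alice_guarantees5_of_units tE tS.
rewrite -card_arcs_induced card_arcs_in.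
have [pos [arc dr]] := induced_planar S plG.
have := edge_count_of_sides (@induced_girth _ S _ girth) (drawing_sides dr).
rewrite [#|induced S|]card_sig (_ : #|[pred x | x \in S]| = #|S|); last by apply: eq_card.
lia.
Qed.

(** * Bob's strategy *)

Section BobWins.
Variables (G : sgraph) (s : nat) (Q : seq G -> Prop).
Hypothesis G_gt0 : 0 < #|G|.
Hypothesis Q1 : forall y, Q [:: y].
Hypothesis Qstep : forall h, uniq h -> odd (size h) -> Q h ->
  (exists2 v, v \notin h & s <= #|marked_nbrs h v|) \/
  (exists w v, [/\ w \notin h, v \notin rcons h w & s <= #|marked_nbrs (rcons h w) v|]) \/
  (exists w, [/\ w \notin h, (size h).+1 < #|G| &
    forall y, y \notin rcons h w -> Q (rcons (rcons h w) y)]).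

Let unmarked (h : seq G) : size h < #|G| -> exists x, x \notin h.
Proof.
move=> hG; case: (pickP (fun v => v \notin h)) => [u uh|h0]; first by exists u.
case/negP: (ltn_geF hG); apply: leq_trans (card_size h).
by apply/subset_leq_card/fintype.subsetP => v _; rewrite -[_ \in _]negbK h0.
Qed.

Let follows_rcons sigma (h : seq G) x : follows sigma h ->
  (~~ odd (size h) -> sigma h = Some x) -> follows sigma (rcons h x).
Proof.
move=> fh hx i; rewrite size_rcons ltnS -cats1 onth_cat take_cat => ih oi.
case: ltngtP ih => // [lt _|E _]; first exact: fh.
by rewrite E subnn /= cats0 hx // -E.
Qed.

(** The guarantee speaks of complete plays, so a position lost for Alice has to be played to the
    end. *)
Let follows_extend sigma (h : seq G) : alice_strategy sigma -> uniq h -> follows sigma h ->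
  exists q, play (h ++ q) /\ follows sigma (h ++ q).
Proof.
move=> str; have [n] := ubnP (#|G| - size h); elim: n h => // n IHn h hn Uh fh.
have hG : size h <= #|G| by rewrite -(card_uniqP Uh) max_card.
move: hG; rewrite leq_eqVlt => /predU1P[e|hG]; first by exists [::]; rewrite cats0.
have [x xh hx] : exists2 x, x \notin h & (~~ odd (size h) -> sigma h = Some x).
  case: (boolP (odd (size h))) => oh; first by have [x xh] := unmarked hG; exists x.
  by have [x xh hx] := str h Uh oh hG; exists x.
have [||q [pq fq]] := IHn (rcons h x) _ _ (follows_rcons fh hx).
- by rewrite size_rcons; lia.
- by rewrite rcons_uniq xh.
- by exists (x :: q); rewrite -cat_rcons.
Qed.

(** [Q] is an invariant of the positions in which Bob is to move. An unmarked vertex with [s] marked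
    neighbours refutes the guarantee, as these precede it in every continuation. The third
    alternative of [Qstep] cannot recur forever in a finite graph. *)
Lemma bob_wins : ~ alice_guarantees G s.
Proof.
case=> sigma str win.
have now h v : uniq h -> follows sigma h -> v \notin h -> s <= #|marked_nbrs h v| -> False.
  move=> Uh fh vh vs; have [q [pq fq]] := follows_extend str Uh fh.
  have := win _ pq fq v; rewrite addn1 ltnNge => /negP[]; apply: leq_trans vs _.
  rewrite back_degree_take //; apply/subset_leq_card/fintype.subsetP => u.
  rewrite !inE (in_take _ (play_mem u pq)) !index_cat (negPf vh) => /andP[-> uh] /=.
  by rewrite uh; apply: leq_trans (leq_addr _ _); rewrite index_mem.
suff H n h : #|G| - size h < n -> uniq h -> follows sigma h -> odd (size h) -> Q h -> False.
  have [y _ sy] := str [::] isT isT G_gt0.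
  apply: (H _ [:: y] (ltnSn _)) => //.
  by case=> // _ _ /=; rewrite sy.
elim: n h => // n IHn h hn Uh fh oh /(Qstep Uh oh) [[v vh vs]|[[w [v [wh vh vs]]]|[w [wh hG Qw]]]].
- exact: now vh vs.
- by apply: now vh vs; [rewrite rcons_uniq wh | apply: follows_rcons; rewrite ?oh].
have fw : follows sigma (rcons h w) by apply: follows_rcons; rewrite ?oh.
have Uw : uniq (rcons h w) by rewrite rcons_uniq wh.
have [||y yw sy] := str (rcons h w) Uw; rewrite ?size_rcons //= ?negbK //.
apply: (IHn (rcons (rcons h w) y)); rewrite ?size_rcons /= ?negbK //.
- by move: hn hG; clear; move: #|G| (size h) => a b; lia.
- by rewrite rcons_uniq yw.
- exact: follows_rcons.
- exact: Qw.
Qed.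
End BobWins.

(** * Bob's potential on a core with pendant vertices *)

Section CoreGame.
Variables (G : sgraph) (K Q : {set G}).
Hypothesis QK : Q \subset K.
Hypothesis pendants : forall v, v \in K -> 2 < #|[set u | adj v u & u \notin K]|.
Hypothesis pendant_private : forall x u v, x \notin K -> adj x u -> adj x v -> u = v.
Let cdeg v := \sum_(u in K) (adj v u : nat).
Hypothesis degQ : forall v, v \in Q -> cdeg v = 2.
Hypothesis degC : forall v, v \in K -> v \notin Q -> 2 < cdeg v.
Hypothesis QQ : forall u v, u \in Q -> v \in Q -> ~~ adj u v.
Hypothesis Qdeg : forall v, v \in K -> \sum_(u in Q) (adj v u : nat) <= 2.
Hypothesis many : 2 * #|Q| + 2 <= #|K|.

Implicit Types h : seq G.
Let U h := [set v in K | v \notin h].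
Let c h v := #|marked_nbrs h v|.
(* Bob is stuck only if [U h] is stable and its vertices have exactly two marked
   neighbours each; then [U h = F h] and [P h = N h], so he wants [N h < P h].  A
   round increases [P - N] by at least 2 if Bob marks a pendant neighbour of a
   vertex of [F h] with at most one marked neighbour, which exists as long as
   [0 < kappa h], and does not decrease it if he marks any other pendant vertex. *)
Let F h := [set v in Q | v \notin h & [forall u, adj v u && (u \notin K) ==> (u \notin h)]].
Let P h := 2 * \sum_(v in U h) c h v + \sum_(u in U h) \sum_(v in U h) (adj u v : nat).
Let N h := 2 * #|U h| + 2 * #|F h|.
Let kappa h := \sum_(q in F h) \sum_(u in U h) (adj q u : nat).

Let FU h : F h \subset U h.
Proof.
by apply/fintype.subsetP => q; rewrite !inE => /and3P[/(fintype.subsetP QK)-> ->].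
Qed.

Let c_rcons h x v : x \notin h -> c (rcons h x) v = c h v + adj v x.
Proof.
move=> xh; rewrite /c /marked_nbrs; case: (boolP (adj v x)) => vx.
  rewrite (_ : [set u | _ & _] = x |: [set u | adj v u & u \in h]).
    by rewrite cardsU1 inE (negPf xh) andbF addnC.
  apply/setP => u; rewrite !inE mem_rcons inE; case: eqP => [->|//] /=.
  by rewrite vx.
rewrite addn0; apply: eq_card => u; rewrite !inE mem_rcons inE.
by case: eqP => [->|//]; rewrite (negPf vx).
Qed.

(** A vertex leaving [F h] takes at most its core degree 2 out of [kappa]. *)
Let mark_pendant h x : x \notin h -> x \notin K ->
  let nU := \sum_(v in U h) (adj v x : nat) in
  let nF := \sum_(v in F h) (adj v x : nat) in
  [/\ U (rcons h x) = U h, P (rcons h x) = P h + 2 * nU,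
      N (rcons h x) + 2 * nF = N h & kappa h <= kappa (rcons h x) + 2 * nF].
Proof.
move=> xh xK nU nF.
have UE : U (rcons h x) = U h.
  apply/setP => v; rewrite !inE mem_rcons inE negb_or; case: (boolP (v \in K)) => //= vK.
  by rewrite (_ : v != x) //; apply: contraNneq xK => <-.
have FE : F (rcons h x) = [set v in F h | ~~ adj v x].
  apply/setP => v; rewrite !inE mem_rcons inE negb_or.
  case: (boolP (v \in Q)) => //= vQ.
  have vx : v != x by apply: contraNneq xK => <-; apply: (fintype.subsetP QK).
  rewrite vx /= -andbA; congr (_ && _); apply/forallP/andP.
    move=> H; split; last by apply/negP => vx'; have := H x; rewrite vx' xK mem_rcons inE eqxx.
    apply/forallP => u; apply/implyP => uK; have := H u.
    by rewrite uK mem_rcons inE negb_or => /andP[].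
  case=> /forallP H nvx u; apply/implyP => /andP[vu uK]; rewrite mem_rcons inE negb_or.
  have := H u; rewrite vu uK /= => ->; rewrite andbT.
  by apply: contraNneq nvx => <-.
have split_F (g : G -> nat) : \sum_(v in F h) g v = \sum_(v in F (rcons h x)) g v + \sum_(v in
  F h | adj v x) g v.
  rewrite (bigID (fun v => adj v x)) addnC FE /=; congr (_ + _).
  by apply: eq_bigl => v; rewrite !inE.
have nFE : nF = \sum_(v in F h | adj v x) 1.
  by rewrite /nF big_mkcondr; apply: eq_bigr => v _; case: (adj v x).
split=> //.
- rewrite /P UE; under eq_bigr => v _ do rewrite c_rcons //.
  by rewrite big_split /= mulnDr addnAC.
- rewrite /N UE -[#|F h|]sum1_card split_F sum1_card nFE; lia.
- rewrite /kappa UE split_F leq_add2l nFE big_distrr /=.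
  apply: leq_sum => v /andP[vF _]; rewrite muln1.
  have vQ : v \in Q by move: vF; rewrite inE => /andP[].
  rewrite -(degQ vQ) /cdeg [X in _ <= X](bigID (fun u => u \notin h)) /=.
  by apply: leq_trans (leq_addr _ _); rewrite leq_eqVlt; apply/orP; left; apply/eqP;
    apply: eq_bigl => u; rewrite inE.
Qed.

(** The edges from [x] to unmarked core vertices pass from the double sum in [P] to the first sum
    with the same weight 2, so only [2 * c h x] is lost. As to [kappa], either [x] is in [F h] and
    only its own term disappears, [Q] being stable, or [x] has at most two neighbours in [Q]. *)
Let mark_core h x : x \in U h ->
  [/\ P (rcons h x) + 2 * c h x = P h,
      N (rcons h x) + 2 + 2 * (x \in F h) = N h & kappa h <= kappa (rcons h x) + 2].
Proof.
rewrite inE => /andP[xK xh]; have xU : x \in U h by rewrite inE xK.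
have UE : U (rcons h x) = U h :\ x.
  by apply/setP => v; rewrite !inE mem_rcons inE negb_or andbCA.
have FE : F (rcons h x) = F h :\ x.
  apply/setP => v; rewrite !inE mem_rcons inE negb_or.
  case: (v =P x) => //= vx; first by rewrite andbF.
  congr [&& _, _ & _]; apply: eq_forallb => u; rewrite mem_rcons inE negb_or.
  by case: (u =P x) => [->|//]; rewrite xK andbF.
have dE : \sum_(u in U h) (adj x u : nat) = \sum_(u in U h :\ x) (adj u x : nat).
  by rewrite (big_setD1 x) //= adj_irrefl; apply: eq_bigr => u _; rewrite adj_sym.
split.
- rewrite /P UE [X in _ = _ * X + _](big_setD1 x) //= [X in _ = _ + X](big_setD1 x) //=.
  under eq_bigr => v _ do rewrite c_rcons //.
  under [X in _ = _ + (_ + X)]eq_bigr => v _ do rewrite (big_setD1 x) //=.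
  by rewrite !big_split /= dE; lia.
- rewrite /N UE FE; have := cardsD1 x (U h); have := cardsD1 x (F h); rewrite xU; lia.
rewrite /kappa UE FE.
have e1 q : \sum_(u in U h) (adj q u : nat) = adj q x + \sum_(u in U h :\ x) (adj q u : nat).
  by rewrite (big_setD1 x).
have leU q : q \in Q -> \sum_(u in U h) (adj q u : nat) <= 2.
  move=> qQ; rewrite -(degQ qQ) /cdeg [X in _ <= X](bigID (fun u => u \notin h)) /=.
  by apply: leq_trans (leq_addr _ _); rewrite leq_eqVlt; apply/orP; left; apply/eqP;
    apply: eq_bigl => u; rewrite inE.
case: (boolP (x \in F h)) => xF.
  have xQ : x \in Q by move: xF; rewrite inE => /andP[].
  rewrite (big_setD1 x) //= addnC leq_add ?leU // (eq_bigr (fun q => \sum_(u in U h :\ x) (adj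
    q u : nat))) // => q.
  rewrite !inE => /and3P[_ qQ _]; rewrite e1 (negPf (QQ qQ xQ)) //.
have -> : F h :\ x = F h.
  by apply/setP => q; rewrite in_setD1; case: eqP => // ->; rewrite (negPf xF).
under eq_bigr => q _ do rewrite e1.
rewrite big_split /= addnC leq_add2l; apply: leq_trans (Qdeg xK).
rewrite [X in _ <= X](bigID (fun q => q \in F h)) /=; apply: leq_trans (leq_addr _ _).
rewrite leq_eqVlt; apply/orP; left; apply/eqP; apply: eq_big => q; last by rewrite adj_sym.
by rewrite andb_idl // !inE => /andP[].
Qed.
Let pendant_free h v : v \in K -> c h v <= 2 ->
  exists x, [/\ x \notin h, x \notin K & adj v x].
Proof.
move=> vK cv; case: (pickP (fun x => [&& x \notin h, x \notin K & adj v x])) => [x /and3P[]|no].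
  by exists x.
have := leq_trans (pendants vK) (subset_leq_card (_ : _ \subset [set u | adj v u & u \in h])).
rewrite ltnNge cv => /(_ _)/negP[] //; apply/fintype.subsetP => x; rewrite !inE => /andP[vx xK].
by rewrite vx; have := no x; rewrite xK vx !andbT => /negbFE.
Qed.

(** A threat is pending, or Bob is ahead in [P - N], or [kappa] still makes up for his deficit. *)
Let good h := (exists2 v, v \in U h & 2 < c h v) \/
  N h < P h \/ 2 * N h + 4 <= 2 * P h + kappa h.

Let start_good y : good [:: y].
Proof.
have UE : U [::] = K by apply/setP => v; rewrite !inE andbT.
have FE : F [::] = Q.
  apply/setP => v; rewrite !inE /= andb_idr // => _; apply/forallP => u.
  by rewrite implybT.
have cE v : c [::] v = 0 by apply: eq_card0 => u; rewrite !inE andbF.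
have kE : kappa [::] = 2 * #|Q|.
  by rewrite /kappa UE FE (eq_bigr (fun=> 2)) => [|q /degQ //]; rewrite sum_nat_const mulnC.
have PE : 2 * #|Q| + 3 * (#|K| - #|Q|) <= P [::].
  have s0 : \sum_(v in K) c [::] v = 0 by apply: big1.
  rewrite /P UE s0 muln0 add0n (big_setID Q) /= (setIidPr QK).
  rewrite leq_add //.
    by rewrite mulnC -sum_nat_const; apply: leq_sum => q /degQ; rewrite /cdeg => ->.
  have := cardsID Q K; rewrite (setIidPr QK) => kk.
  rewrite (_ : #|K| - #|Q| = #|K :\: Q|); last by lia.
  by rewrite mulnC -sum_nat_const; apply: leq_sum => v; rewrite inE => /andP[vQ vK]; apply: degC.
have NE : N [::] = 2 * #|K| + 2 * #|Q| by rewrite /N UE FE.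
have QleK := subset_leq_card QK.
(* Before the first move [2 * P + kappa - 2 * N] is at least [2 * #|K| - 4 * #|Q|], hence at least 4
   by [many]; the move of Alice does not lower it. *)
right; right; have [yK|yK] := boolP (y \in K).
  have yU : y \in U [::] by rewrite UE.
  by have [h1 h2 h3] := mark_core yU; rewrite cE in h1; rewrite /= in h1 h2 h3; lia.
by have [_ h1 h2 h3] := @mark_pendant [::] y isT yK; rewrite /= in h1 h2 h3; lia.
Qed.

(** Bob's move gains at least 2 in [P - N], and at least 6 in [2 * (P - N) + kappa] if it hits [F];
    Alice's reply takes back at most 2 and 6, respectively. *)
Let round_gain p p1 p2 n n1 n2 k k1 k2 u f (Fv : Prop) :
  p1 = p + 2 * u -> n1 + 2 * f = n -> k <= k1 + 2 * f -> 0 < u -> (Fv -> 0 < f) ->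
  p1 + n2 <= p2 + n1 + 2 -> 2 * p1 + k1 + 2 * n2 <= 2 * p2 + k2 + 2 * n1 + 6 ->
  n < p \/ Fv /\ 2 * n + 4 <= 2 * p + k -> n2 < p2 \/ 2 * n2 + 4 <= 2 * p2 + k2.
Proof. by move=> ? ? ? ? H ? ? [|[/H]]; lia. Qed.

Let core_gain p1 p2 n1 n2 k1 k2 a b : p2 + 2 * a = p1 -> n2 + 2 + 2 * b = n1 ->
  k1 <= k2 + 2 -> a <= 2 ->
  p1 + n2 <= p2 + n1 + 2 /\ 2 * p1 + k1 + 2 * n2 <= 2 * p2 + k2 + 2 * n1 + 6.
Proof. by move=> *; split; lia. Qed.

Let pendant_gain p1 p2 n1 n2 k1 k2 a b : p2 = p1 + 2 * a -> n2 + 2 * b = n1 ->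
  k1 <= k2 + 2 * b ->
  p1 + n2 <= p2 + n1 + 2 /\ 2 * p1 + k1 + 2 * n2 <= 2 * p2 + k2 + 2 * n1 + 6.
Proof. by move=> *; split; lia. Qed.

(** After the hit [v] has at most two marked neighbours, and [x] touches no other vertex. So any
    core vertex Alice marks in reply has at most two marked neighbours, as [core_gain] requires. *)
Let hit_step h v x y : v \in U h -> c h v <= 1 -> (forall u, u \in U h -> c h u <= 2) ->
  x \notin h -> x \notin K -> adj v x -> y \notin rcons h x ->
  N h < P h \/ v \in F h /\ 2 * N h + 4 <= 2 * P h + kappa h ->
  good (rcons (rcons h x) y).
Proof.
move=> vU cv call xh xK vx yh J; right.
have [UE P1 N1 k1] := mark_pendant xh xK.
have nU : 0 < \sum_(v in U h) (adj v x : nat) by rewrite (big_setD1 v) //= vx.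
have nF : v \in F h -> 0 < \sum_(v in F h) (adj v x : nat).
  by move=> vF; rewrite (big_setD1 v) //= vx.
have c2 u : u \in U h -> c (rcons h x) u <= 2.
  move=> uU; rewrite c_rcons //; case: (boolP (adj u x)) => ux; last by rewrite addn0 call.
  by rewrite (pendant_private xK (u := u) (v := v)) ?addn1 // adj_sym.
have [yK|yK] := boolP (y \in K).
  have yU : y \in U (rcons h x) by rewrite inE yK.
  have [P2 N2 k2] := mark_core yU; have := c2 y; rewrite -UE yU => /(_ isT) cy.
  have [g1 g2] := core_gain P2 N2 k2 cy; exact: round_gain P1 N1 k1 nU nF g1 g2 J.
have [_ P2 N2 k2] := mark_pendant yh yK.
have [g1 g2] := pendant_gain P2 N2 k2; exact: round_gain P1 N1 k1 nU nF g1 g2 J.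
Qed.

Lemma bob_wins_core : ~ alice_guarantees G 4.
Proof.
apply: (@bob_wins _ _ good); last 1 first.
- move=> h Uh oh gh.
  have room v x : v \in U h -> x \notin h -> x \notin K -> (size h).+1 < #|G|.
    rewrite inE => /andP[vK vh] xh xK; rewrite -[_.+2]/(size [:: v, x & h]).
    have /card_uniqP <- : uniq [:: v, x & h].
      rewrite !cons_uniq Uh xh andbT inE negb_or vh !andbT.
      by apply: contraNneq xK => <-.
    exact: max_card.
  have [[v vU cv]|ch] : (exists2 v, v \in U h & 2 < c h v) \/ forall v, v \in U h -> c h v <= 2.
    case: (pickP (fun v => (v \in U h) && (2 < c h v))) => [v /andP[]|no]; first by left; exists v.
    by right=> v vU; have := no v; rewrite vU /= ltnNge => /negbFE.
  + have [vK vh] : v \in K /\ v \notin h by move: vU; rewrite inE => /andP[].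
    case: (leqP 4 (c h v)) => c4; first by left; exists v.
    (* Having at least three pendant and two core neighbours, [v] still has an unmarked neighbour,
       which Bob marks as the fourth. *)
    right; left; case: (pickP (fun w => adj v w && (w \notin h))) => [w /andP[vw wh]|no];
      last first.
      have : #|[set u | adj v u & u \notin K]| + cdeg v <= c h v.
        rewrite /c /marked_nbrs -(cardsID K [set u | adj v u & u \in h]) addnC leq_add //.
          rewrite /cdeg -sum1_card (eq_bigr (fun u => if adj v u then 1 else 0));
            last by move=> u _; case: (adj v u).
          rewrite -big_mkcondr leq_eqVlt; apply/orP; left; apply/eqP; apply: eq_bigl => u.
          rewrite !inE andbC; case: (boolP (adj v u)) => //= vu.
          by have := no u; rewrite vu => /negbFE->.
        apply/subset_leq_card/fintype.subsetP => u; rewrite !inE => /andP[vu ->].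
        by have := no u; rewrite vu => /negbFE->.
      have := pendants vK; have : 1 < cdeg v.
        by case: (boolP (v \in Q)) => vQ; [rewrite degQ | apply: ltnW; apply: degC].
      lia.
    exists w, v; split=> //.
      rewrite mem_rcons inE negb_or vh andbT; apply: contraTneq vw => ->.
      by rewrite adj_irrefl.
    by rewrite -/(c _ v) c_rcons // vw; lia.
  right; right.
  have [T|T] := ltnP (N h) (P h); last first.
    have k4 : 2 * N h + 4 <= 2 * P h + kappa h.
      case: gh => [[v vU]|[|//]]; first by rewrite ltnNge ch.
      by rewrite ltnNge T.
    (* Bob is not ahead, so [kappa h] is positive. *)
    have [q qF [u uU qu]] : exists2 q, q \in F h & exists2 u, u \in U h & adj q u.
      case: (pickP (fun d : G * G => [&& d.1 \in F h, d.2 \in U h & adj d.1 d.2])) => [[q u]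
        /and3P[]|no].
        by exists q => //; exists u.
      suff : kappa h = 0 by lia.
      apply: big1 => q qF; apply: big1 => u uU.
      by have := no (q, u); rewrite /= qF uU /= => ->.
    have qU := fintype.subsetP (FU h) q qF.
    have [qQ qh qout] : [/\ q \in Q, q \notin h & forall u, adj q u -> u \notin K -> u \notin h].
      move: qF; rewrite !inE => /and3P[qQ qh /forallP qo]; split=> // w qw wK.
      by have := qo w; rewrite qw wK.
    have qK := fintype.subsetP QK q qQ.
    (* The pendants of [q] and its core neighbour [u] are unmarked, which leaves one other
       neighbour. *)
    have cq : c h q <= 1.
      have [uK uh] : u \in K /\ u \notin h by move: uU; rewrite inE => /andP[].
      have := degQ qQ; rewrite /cdeg (big_setD1 u) //= qu => -[d1].
      have <- : #|[set w in K :\ u | adj q w]| = 1.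
        by rewrite -[RHS]d1 -sum1dep_card big_mkcondr; apply: eq_bigr => w _; case: (adj q w).
      apply/subset_leq_card/fintype.subsetP => w; rewrite !inE => /andP[qw wh].
      have wK : w \in K by apply: contraLR wh; apply: qout.
      by rewrite qw wK !andbT; apply: contraNneq uh => <-.
    have [x [xh xK qx]] := pendant_free qK (leqW cq).
    exists x; split=> //; first exact: room qU xh xK.
    by move=> y yh; apply: hit_step qU cq ch xh xK qx yh _; right.
  have [[v vU cv]|c2] : (exists2 v, v \in U h & c h v <= 1) \/ forall v, v \in U h -> c h v = 2.
    case: (pickP (fun v => (v \in U h) && (c h v <= 1))) => [v /andP[]|no]; first by left; exists v.
    by right=> v vU; have := no v; have := ch v vU; rewrite vU /=; lia.
  + have vK : v \in K by move: vU; rewrite inE => /andP[].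
    have [x [xh xK vx]] := pendant_free vK (leqW cv).
    exists x; split=> //; first exact: room vU xh xK.
    by move=> y yh; apply: hit_step vU cv ch xh xK vx yh _; left.
  (* Now every vertex of [U h] has two marked neighbours. On an edge inside [U h] Bob hits [v]; if
     Alice answers by marking [v], then [u] gets its third marked neighbour. *)
  case: (pickP (fun d : G * G => [&& d.1 \in U h, d.2 \in U h & adj d.1 d.2])) => [[u v]
    /and3P[/= uU vU uv]|no].
    have vK : v \in K by move: vU; rewrite inE => /andP[].
    have [x [xh xK vx]] := pendant_free vK (ch v vU).
    exists x; split=> //; first exact: room vU xh xK.
    move=> y yh; left; have [UE _ _ _] := mark_pendant xh xK.
    have U2 w : w \in U h -> w != y -> w \in U (rcons (rcons h x) y).
      by rewrite -UE !inE => /andP[-> wh] wy; rewrite mem_rcons inE negb_or wy.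
    have [yv|yv] := eqVneq y v.
      exists u; first by apply: U2 => //; rewrite yv; apply: contraTneq uv => ->;
        rewrite adj_irrefl.
      by rewrite yv !c_rcons -?yv // yv uv c2 //; case: (adj u x).
    exists v; first by apply: U2; rewrite // eq_sym.
    by rewrite !c_rcons // vx c2 //; case: (adj v y).
  suff : P h = N h by lia.
  have UF : U h = F h.
    apply/eqP; rewrite eqEsubset FU andbT; apply/fintype.subsetP => v vU.
    have [vK vh] : v \in K /\ v \notin h by move: vU; rewrite inE => /andP[].
    have cK u : u \in K -> adj v u -> u \in h.
      move=> uK vu; apply: contraT => uh; have := no (v, u); rewrite /= vU vu andbT.
      by rewrite inE uK uh.
    have cE : c h v = cdeg v + #|[set u | [&& adj v u, u \notin K & u \in h]]|.
      rewrite /c /marked_nbrs -(cardsID K [set u | adj v u & u \in h]); congr (_ + _).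
        rewrite /cdeg -sum1_card [RHS](eq_bigr (fun u => if adj v u then 1 else 0));
          last by move=> u _; case: (adj v u).
        rewrite -big_mkcondr; apply: eq_bigl => u; rewrite !inE andbC.
        by case: (boolP (u \in K)) => //= uK; rewrite andb_idr // => /(cK _ uK).
      by apply: eq_card => u; rewrite !inE andbCA.
    rewrite c2 // in cE.
    (* All core neighbours of [v] are marked, so its two marked neighbours leave no room for core
       degree 3 or for a marked pendant. *)
    have vQ : v \in Q by apply: contraT => vQ; have := degC vK vQ; lia.
    rewrite inE vQ vh /=; apply/forallP => u; apply/implyP => /andP[vu uK].
    rewrite degQ // in cE; apply/negP => uh.
    have : 0 < #|[set u | [&& adj v u, u \notin K & u \in h]]|.
      by apply/card_gt0P; exists u; rewrite inE vu uK.
    by move/eqP: cE; rewrite -{1}[2]addn0 eqn_add2l => /eqP <-.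
  rewrite /P /N -UF (eq_bigr (fun=> 2)) // sum_nat_const big1 ?addn0.
    by rewrite muln2 !mul2n addnn.
  move=> u uU; apply: big1 => v vU; have := no (u, v).
  by rewrite /= uU vU /= => ->.
- by apply: leq_trans (max_card (mem K)); apply: leq_trans many; rewrite addn2.
- exact: start_good.
Qed.
End CoreGame.

(** * A plane graph of girth 8 *)

Local Delimit Scope Z_scope with BZ.

(* Vertices 0 to 19 are those of the dodecahedron and 20 to 37 subdivide edges.
   In the graph, [(v, 0)] is the vertex [v] and [(v, 1)], [(v, 2)], [(v, 3)] are
   its pendant neighbours. *)
Definition core_nbrs (v : nat) : seq nat := nth [::] [::
  [:: 9; 20; 21]; [:: 2; 20; 22]; [:: 1; 3; 24]; [:: 2; 4; 26]; [:: 3; 27; 28];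
  [:: 6; 27; 29]; [:: 5; 31; 32]; [:: 8; 17; 31]; [:: 7; 18; 35]; [:: 0; 35; 37];
  [:: 12; 21; 36]; [:: 19; 22; 23]; [:: 10; 24; 25]; [:: 15; 23; 26]; [:: 16; 25; 28];
  [:: 13; 29; 30]; [:: 14; 32; 33]; [:: 7; 30; 34]; [:: 8; 33; 36]; [:: 11; 34; 37];
  [:: 0; 1]; [:: 0; 10]; [:: 1; 11]; [:: 11; 13]; [:: 2; 12]; [:: 12; 14]; [:: 3; 13];
  [:: 4; 5]; [:: 4; 14]; [:: 5; 15]; [:: 15; 17]; [:: 6; 7]; [:: 6; 16]; [:: 16; 18];
  [:: 17; 19]; [:: 8; 9]; [:: 10; 18]; [:: 9; 19]] v.

Definition grid_point (a : nat * nat) : Z * Z := nth (0, 0)%BZ (nth [::] [::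
  [:: (145, 217); (149, 217); (147, 218); (146, 219)];
  [:: (100, 185); (101, 188); (98, 188); (96, 186)];
  [:: (56, 153); (57, 156); (55, 158); (54, 155)];
  [:: (74, 101); (71, 102); (72, 100); (72, 98)];
  [:: (90, 49); (90, 45); (91, 46); (93, 47)];
  [:: (145, 49); (142, 46); (145, 47); (148, 46)];
  [:: (200, 49); (202, 48); (204, 50); (202, 51)];
  [:: (215, 101); (216, 98); (219, 100); (219, 103)];
  [:: (233, 153); (235, 155); (234, 158); (231, 157)];
  [:: (188, 185); (193, 186); (190, 187); (187, 189)];
  [:: (144, 274); (146, 275); (144, 278); (142, 275)];
  [:: (122, 154); (124, 155); (124, 157); (122, 157)];
  [:: (2, 170); (2, 172); (0, 171); (0, 168)];
  [:: (108, 112); (105, 109); (108, 110); (110, 108)];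
  [:: (57, 3); (53, 4); (55, 1); (58, 1)]; [:: (144, 86); (140, 86); (141, 84); (142, 82)];
  [:: (233, 3); (232, 1); (235, 0); (237, 4)];
  [:: (181, 112); (185, 113); (183, 114); (182, 116)];
  [:: (287, 170); (290, 167); (291, 171); (288, 174)];
  [:: (167, 154); (169, 152); (171, 153); (169, 155)];
  [:: (124, 199); (123, 195); (126, 196); (127, 199)];
  [:: (143, 245); (140, 248); (139, 245); (140, 242)];
  [:: (111, 169); (108, 169); (108, 167); (110, 165)];
  [:: (113, 134); (112, 136); (110, 135); (110, 132)];
  [:: (29, 160); (27, 159); (28, 157); (31, 156)];
  [:: (29, 86); (26, 88); (26, 85); (28, 83)];
  [:: (91, 107); (93, 110); (90, 110); (89, 108)];
  [:: (118, 51); (121, 54); (118, 55); (115, 54)];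
  [:: (72, 27); (71, 32); (70, 29); (68, 26)];
  [:: (146, 68); (149, 65); (150, 68); (148, 70)];
  [:: (163, 98); (162, 93); (166, 94); (165, 98)];
  [:: (206, 76); (205, 79); (203, 77); (204, 75)];
  [:: (216, 25); (213, 25); (213, 23); (215, 21)];
  [:: (259, 87); (257, 91); (255, 88); (255, 85)];
  [:: (172, 132); (168, 134); (168, 131); (170, 128)];
  [:: (210, 168); (206, 167); (208, 164); (210, 166)];
  [:: (214, 220); (211, 220); (211, 216); (215, 215)];
  [:: (176, 170); (176, 172); (173, 172); (173, 169)]]%BZ a.1) a.2.

Definition label : finType := ('I_38 * 'I_4)%type.
Definition code (x : label) : nat * nat := (val x.1, val x.2).

Definition code_adj (a b : nat * nat) : bool :=
  if (a.2 == 0) && (b.2 == 0) then b.1 \in core_nbrs a.1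
  else (a.1 == b.1) && ((a.2 == 0) (+) (b.2 == 0)).

Definition code_edges : seq ((nat * nat) * (nat * nat)) :=
  [seq ((v, 0), (w, 0)) | v <- iota 0 38, w <- [seq w <- core_nbrs v | v < w]] ++
  [seq ((v, 0), (v, r)) | v <- iota 0 38, r <- iota 1 3].

Definition orientZ (a b c : Z * Z) : Z :=
  Z.sub (Z.mul (Z.sub b.1 a.1) (Z.sub c.2 a.2)) (Z.mul (Z.sub b.2 a.2) (Z.sub c.1 a.1)).

Definition eqPZ (a b : Z * Z) : bool := Z.eqb a.1 b.1 && Z.eqb a.2 b.2.

Definition same_side (x y : Z) : bool := Z.ltb 0 (Z.mul x y).

(** A sufficient test by signs of determinants: the ends of one segment lie strictly on one side of
    the line through the other, or exactly one of [c], [d] lies on the line through [a] and [b], and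
    it is [a] or [b]. *)
Definition meet_at_ends (a b c d : Z * Z) : bool :=
  let o1 := orientZ a b c in let o2 := orientZ a b d in
  [|| same_side o1 o2, same_side (orientZ c d a) (orientZ c d b),
      [&& Z.eqb o1 0, ~~ Z.eqb o2 0 & eqPZ c a || eqPZ c b] |
      [&& Z.eqb o2 0, ~~ Z.eqb o1 0 & eqPZ d a || eqPZ d b]].

Lemma code_edges_meet : pairwise
  (fun d e => meet_at_ends (grid_point d.1) (grid_point d.2) (grid_point e.1) (grid_point e.2))
  code_edges.
Proof. by vm_compute. Qed.

(** Finite checks are computed on pairs of naturals and transferred to [label] by [code_mem]. *)
Definition codes : seq (nat * nat) := [seq (v, r) | v <- iota 0 38, r <- iota 0 4].

Lemma code_mem (x : label) : code x \in codes.
Proof. by apply/allpairsP; exists (code x); rewrite !mem_iota /=; split=> //;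
  case: x => x y /=. Qed.

Lemma code_inj : injective code.
Proof. by move=> [x r] [y s] [/val_inj-> /val_inj->]. Qed.

Lemma code_adj_sym (x y : label) : code_adj (code x) (code y) = code_adj (code y) (code x).
Proof.
have /allP/(_ _ (code_mem x))/allP/(_ _ (code_mem y))/eqP// :
  all (fun a => all (fun b => code_adj a b == code_adj b a) codes) codes by vm_compute.
Qed.

Lemma code_adj_irrefl (x : label) : code_adj (code x) (code x) = false.
Proof.
have /allP/(_ _ (code_mem x))/negPf// : all (fun a => ~~ code_adj a a) codes by vm_compute.
Qed.

Definition dodeca : sgraph := @SGraph label (fun x y => code_adj (code x) (code y))
  code_adj_sym code_adj_irrefl.

Lemma code_edgesP (x y : dodeca) : adj x y ->
  ((code x, code y) \in code_edges) || ((code y, code x) \in code_edges).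
Proof.
move=> xy; have /allP/(_ _ (code_mem x))/allP/(_ _ (code_mem y)) : all (fun a => all (fun b =>
  if code_adj a b then ((a, b) \in code_edges) || ((b, a) \in code_edges) else true)
  codes) codes by vm_compute.
by rewrite -[code_adj _ _]/(adj x y) xy.
Qed.

(** * Planarity of the example, by a straight-line drawing *)

Section StraightDrawing.
Local Open Scope ring_scope.
Variable R : realType.

Let zr (z : Z) : R := (int_of_Z z)%:~R.

Let zrM a b : zr (Z.mul a b) = zr a * zr b.
Proof. by rewrite /zr -intrM -rmorphM. Qed.

Let zrB a b : zr (Z.sub a b) = zr a - zr b.
Proof. by rewrite /zr -intrB -rmorphB. Qed.

Let zr_gt0 a : Z.ltb 0 a -> 0 < zr a.
Proof. by case: a => // p _; rewrite /zr ltr0z /=; have := Pos2Nat.is_pos p; lia. Qed.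

Let zr_inj : injective zr.
Proof. by move=> a b /eqP; rewrite eqr_int => /eqP/(can_inj int_of_ZK). Qed.

Let embed (p : Z * Z) : 'rV[R]_2 := \row_j (if j == 0 then zr p.1 else zr p.2).

Let embed_inj : injective embed.
Proof.
move=> [a b] [c d] /rowP E; have := E 0; have := E 1; rewrite !mxE /=.
by move=> /zr_inj-> /zr_inj->.
Qed.

Let eqPZP a b : eqPZ a b -> a = b.
Proof. by case: a b => [a b] [c d] /andP[/Z.eqb_eq /= -> /Z.eqb_eq /= ->]. Qed.

Let orient (a b c : 'rV[R]_2) := (b 0 0 - a 0 0) * (c 0 1 - a 0 1) - (b 0 1 - a 0 1) * (c 0 0 -
  a 0 0).

Let orientE a b c : orient (embed a) (embed b) (embed c) = zr (orientZ a b c).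
Proof. by rewrite /orient /orientZ !mxE /= zrB !zrM !zrB. Qed.

(** [orient a b] is affine in its last argument and vanishes on the line through [a] and [b]. *)
Let orient_seg a b c d q : segment a b q -> segment c d q ->
  exists t : R, [/\ 0 <= t <= 1, q = (1 - t) *: c + t *: d &
    (1 - t) * orient a b c + t * orient a b d = 0].
Proof.
case=> s [_ qs] [t [t01 qt]]; exists t; split=> //.
transitivity (orient a b q); first by rewrite qt /orient !mxE; ring.
by rewrite qs /orient !mxE; ring.
Qed.

Let segment_sym (a b : 'rV[R]_2) : segment a b = segment b a.
Proof.
by apply/seteqP; split=> q [t [/andP[t0 t1] ->]]; exists (1 - t);
  rewrite subr_ge0 t1 gerBl t0 subKr addrC.
Qed.

(** A convex combination of two numbers of the same strict sign is not zero; if exactly one of them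
    is zero, the combination vanishes only at the corresponding end. *)
Let meet_at_endsP a b c d q : meet_at_ends a b c d ->
  segment (embed a) (embed b) q -> segment (embed c) (embed d) q ->
  (q = embed a \/ q = embed b) /\ (q = embed c \/ q = embed d).
Proof.
move=> m hab hcd; have [t [/andP[t0 t1] qt et]] := orient_seg hab hcd.
have [s [/andP[s0 s1] qs es]] := orient_seg hcd hab.
rewrite !orientE in et es.
have side x y u : same_side x y -> 0 <= u -> u <= 1 -> (1 - u) * zr x + u * zr y != 0.
  move=> /zr_gt0; rewrite zrM => xy u0 u1; apply/eqP => E.
  have : zr x * ((1 - u) * zr x + u * zr y) = 0 by rewrite E mulr0.
  have : zr y * ((1 - u) * zr x + u * zr y) = 0 by rewrite E mulr0.
  have x0 : zr x != 0 by apply: contraTneq xy => ->; rewrite mul0r ltxx.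
  have y0 : zr y != 0 by apply: contraTneq xy => ->; rewrite mulr0 ltxx.
  have xx : 0 < zr x * zr x by rewrite -expr2 exprn_even_gt0.
  have yy : 0 < zr y * zr y by rewrite -expr2 exprn_even_gt0.
  nra.
have nz x : ~~ Z.eqb x 0 -> zr x != 0.
  by apply: contraNneq => x0; apply/Z.eqb_eq/zr_inj; rewrite x0.
case/or4P: m => [h|h|/and3P[/Z.eqb_eq o1 /nz o2 h]|/and3P[/Z.eqb_eq o2 /nz o1 h]].
- by have := side _ _ _ h t0 t1; rewrite et eqxx.
- by have := side _ _ _ h s0 s1; rewrite es eqxx.
- rewrite o1 mulr0 add0r in et; move/eqP: et; rewrite mulf_eq0 (negPf o2) orbF => /eqP tz.
  have qc : q = embed c by rewrite qt tz subr0 scale1r scale0r addr0.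
  by split; [case/orP: h => /eqPZP <-; [left|right] | left].
rewrite o2 mulr0 addr0 in et; move/eqP: et; rewrite mulf_eq0 (negPf o1) orbF => /eqP tz.
have qd : q = embed d by rewrite qt tz scale0r add0r (_ : t = 1) ?scale1r //; lra.
by split; [case/orP: h => /eqPZP <-; [left|right] | right].
Qed.

Let pos (x : dodeca) := embed (grid_point (code x)).

Let pos_inj : injective pos.
Proof.
move=> x y /embed_inj E; apply: code_inj; apply/eqP.
have /allP/(_ _ (code_mem x))/allP/(_ _ (code_mem y))/implyP : all (fun a => all (fun b =>
  eqPZ (grid_point a) (grid_point b) ==> (a == b)) codes) codes by vm_compute.
by apply; rewrite E /eqPZ !Z.eqb_refl.
Qed.

Let edge_meet (x y x' y' : dodeca) q : adj x y -> adj x' y' ->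
  [set x; y] <> [set x'; y'] ->
  segment (pos x) (pos y) q -> segment (pos x') (pos y') q -> q = pos x \/ q = pos y.
Proof.
have key (u v u' v' : dodeca) : (code u, code v) \in code_edges ->
    (code u', code v') \in code_edges -> [set u; v] <> [set u'; v'] ->
    segment (pos u) (pos v) q -> segment (pos u') (pos v') q -> q = pos u \/ q = pos v.
  move=> uv uv' ne h h'; have /(pairwiseP ((0, 0), (0, 0))) E := code_edges_meet.
  have [k ks ku] := nthP ((0, 0), (0, 0)) uv; have [m ms mu] := nthP ((0, 0), (0, 0)) uv'.
  have [km|mk|km] := ltngtP k m.
  - have := E k m ks ms km; rewrite ku mu /= => M.
    by have [] := meet_at_endsP M h h'.
  - have := E m k ms ks mk; rewrite ku mu /= => M.
    by have [] := meet_at_endsP M h' h.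
  - rewrite -km ku in mu; case: ne.
    by rewrite (code_inj (congr1 fst mu)) (code_inj (congr1 snd mu)).
have swap (u v : dodeca) : [set u; v] = [set v; u] by rewrite finset.setUC.
move=> /code_edgesP/orP[xy|xy] /code_edgesP/orP[xy'|xy'] ne h h'.
- exact: key xy xy' ne h h'.
- by apply: key xy xy' _ h _; [rewrite -(swap x') | rewrite segment_sym].
- by apply/or_comm; apply: key xy xy' _ _ h'; [rewrite -(swap x) | rewrite segment_sym].
- by apply/or_comm; apply: key xy xy' _ _ _;
  [rewrite -(swap x) -(swap x') | rewrite segment_sym | rewrite segment_sym].
Qed.

Lemma dodeca_planar : planar R dodeca.
Proof.
have ne (x y : dodeca) : adj x y -> x != y.
  by apply: contraTneq => ->; rewrite adj_irrefl.
exists pos, (fun x y => segment (pos x) (pos y)); split.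
- exact: pos_inj.
- by move=> x y _; apply: segment_sym.
- move=> x y xy; exists [:: pos y]; split=> //=.
    split=> //; first by move/pos_inj/eqP; rewrite (negPf (ne _ _ xy)).
    by apply/seteqP; split=> q [] // ->; split=> //; apply: mem_segment_r.
  by apply/seteqP; split=> q; [left | case=> // ->; apply: mem_segment_r].
- move=> x y w xy [h nxy].
  (* Every vertex lies on an edge, so a vertex inside an arc would be a forbidden meeting of two
     edges. *)
  have [w' ww'] : exists w' : dodeca, adj w w'.
    case: w {h nxy} => v r; have [r0|r0] := eqVneq r ord0.
      by exists (v, ord_max); rewrite /= /code_adj /= r0 /= eqxx.
    exists (v, ord0); rewrite /= /code_adj /= eqxx /=.
    have -> : (val r == 0)%N = false by apply/negbTE; apply: contraNneq r0 => r0; apply/eqP/val_inj.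
    by rewrite /= eqxx.
  apply: nxy; have [|wxy] := boolP (w \in [set x; y]).
    by rewrite !inE => /orP[]/eqP->; [left | right].
  apply: (edge_meet xy ww' _ h (mem_segment_l _ _)) => E.
  by case/negP: wxy; rewrite E set21.
- move=> x y x' y' xy xy' E; apply/seteqP; split=> // q [[h nxy] h'].
  by apply: nxy; apply: edge_meet xy xy' E h h'.
Qed.
End StraightDrawing.

(* [short_free n v [::] v] says that no core cycle of length at most [n] passes
   through [v]; [seen] lists the vertices visited before [v]. *)
Fixpoint short_free (n v0 : nat) (seen : seq nat) (v : nat) : bool :=
  if n is n'.+1 then
    (if 1 < size seen then v0 \notin core_nbrs v else true) &&
    all (fun w => if w \in v :: seen then true else short_free n' v0 (v :: seen) w) (core_nbrs v)
  else true.

(** The bound on [size seen + size p] rules out closing up by going back along the first edge. *)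
Lemma short_freeP n v0 seen v p : short_free n v0 seen v ->
  path (fun a b => b \in core_nbrs a) v p -> uniq (v :: p) ->
  {in v :: p, forall a, a \notin seen} -> size p < n -> 1 < size seen + size p ->
  v0 \notin core_nbrs (last v p).
Proof.
elim: n v p seen => // n IHn v [|w p] seen /= /andP[h /allP a].
  by rewrite addn0 => _ _ _ _ s1; rewrite s1 in h.
move=> /andP[vw pw] /andP[vp wp] ns pn s1; have := a w vw.
case: ifP => [|_ sf]; first rewrite inE.
  case/predU1P=> [wv|ws]; first by rewrite wv inE eqxx in vp.
  by have := ns w; rewrite !inE eqxx orbT ws => /(_ isT).
apply: IHn sf pw wp _ pn _; last by rewrite /= addSnnS.
move=> b bp; rewrite inE negb_or; apply/andP; split; first by apply: contraNneq vp => <-.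
by apply: ns; rewrite inE bp orbT.
Qed.

Lemma dodeca_girth : girth_geq dodeca 8.
Proof.
move=> c [c3 Uc cc]; rewrite leqNgt; apply/negP => c8.
(* A pendant vertex has a single neighbour, which would be both its predecessor and its successor on
   the cycle. *)
have core (x : dodeca) : x \in c -> x.2 = ord0.
  move=> xc; apply: contraTeq isT => x0.
  have only (y : dodeca) : adj x y -> y = (x.1, ord0).
    case: x y x0 {xc} => v r [w s] /= r0; rewrite /code_adj /=.
    have -> : (val r == 0) = false by apply/negbTE; apply: contraNneq r0 => r0; apply/eqP/val_inj.
    by rewrite /= => /andP[/eqP/val_inj-> /eqP s0]; congr pair; apply: val_inj.
  have [i p ip] := rot_to xc.
  have := Uc; rewrite -(rot_uniq i) ip; have := cc; rewrite -(rot_cycle i) ip.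
  have := @adj_sym dodeca; move: (@adj dodeca) only => e only esym.
  have : 3 <= size (x :: p) by rewrite -ip size_rot.
  case: p {ip} => [|y [|z p]] //= _; rewrite rcons_path => /and3P[/only-> _].
  rewrite esym => /andP[_ /only xl] /and3P[_ + _].
  by rewrite -xl; case/negP; apply: mem_last.
case: c c3 Uc cc c8 core => // x p c3 Uc cc c8 core.
pose h (z : dodeca) := val z.1.
have sf : short_free 7 (h x) [::] (h x).
  have /allP : all (fun v => short_free 7 v [::] v) (iota 0 38) by vm_compute.
  by apply; rewrite mem_iota; apply: (ltn_ord x.1).
have adjE (y z : dodeca) : y.2 = ord0 -> z.2 = ord0 -> adj y z = (h z \in core_nbrs (h y)).
  by move=> y0 z0; rewrite /= /code_adj /= y0 z0.
have : path (@adj dodeca) x (rcons p x) by [].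
rewrite rcons_path => /andP[pp]; rewrite adjE ?core ?mem_head ?mem_last // -(last_map h).
apply/negP; apply: (short_freeP sf).
- rewrite path_map; apply: (@sub_in_path _ (fun z : dodeca => z.2 == ord0) _ _ _ _ _ _ pp).
    by move=> y z /eqP y0 /eqP z0; rewrite (adjE y z y0 z0).
  by apply/allP => z /core/eqP.
- rewrite -[_ :: _]/(map h (x :: p)) map_inj_in_uniq // => -[a r] [b s] /core /= -> /core /= ->.
  by rewrite /h /= => /val_inj->.
- by [].
- by rewrite size_map.
- by rewrite size_map.
Qed.

Lemma dodeca_bob : ~ alice_guarantees dodeca 4.
Proof.
pose K : {set dodeca} := [set x | x.2 == ord0].
pose Q : {set dodeca} := [set x in K | 20 <= val x.1].
(* Sums over core vertices become sums of lists of naturals, which can be evaluated. *)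
have sumK (P : pred nat) (g : nat -> nat) : \sum_(x in K | P (val x.1)) g (val x.1) =
    sumn [seq (if P w then g w else 0) | w <- iota 0 38].
  rewrite sumnE big_map -[iota 0 38]/(index_iota 0 38) big_mkord big_mkcondr /=.
  rewrite (reindex_onto (fun w : 'I_38 => (w, ord0 : 'I_4)) fst) /=; last first.
    by move=> [w r]; rewrite inE /= => /eqP->.
  by apply: eq_bigl => w; rewrite inE !eqxx.
have adjK (x y : dodeca) : x \in K -> y \in K -> adj x y = (val y.1 \in core_nbrs (val x.1)).
  by rewrite !inE => /eqP x0 /eqP y0; rewrite /= /code_adj /= x0 y0.
have all38 (P : pred nat) : all P (iota 0 38) -> forall x : dodeca, P (val x.1).
  by move/allP=> PP x; apply: PP; rewrite mem_iota; apply: (ltn_ord x.1).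
have cdegE x : x \in K -> \sum_(u in K) (adj x u : nat) =
    sumn [seq (w \in core_nbrs (val x.1) : nat) | w <- iota 0 38].
  move=> xK; rewrite (eq_bigr (fun u : dodeca => (val u.1 \in core_nbrs (val x.1)) : nat));
    last first.
    by move=> u uK; rewrite (adjK x u xK uK).
  rewrite -[RHS](sumK xpredT (fun w => (w \in core_nbrs (val x.1)) : nat)).
  by apply: eq_bigl => u; rewrite andbT.
have cardE (P : pred nat) : #|[set x in K | P (val x.1)]| = sumn [seq (if P w then 1 else 0) |
  w <- iota 0 38].
  by rewrite -sum1_card -(sumK P (fun=> 1)); apply: eq_bigl => x; rewrite !inE.
have privP (x y : dodeca) : x \notin K -> adj x y -> y = (x.1, ord0).
  case: x y => v r [w s]; rewrite inE /= /code_adj /= => r0.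
  have -> : (val r == 0) = false by apply/negbTE; apply: contraNneq r0 => r0; apply/eqP/val_inj.
  by rewrite /= => /andP[/eqP/val_inj-> /eqP s0]; congr pair; apply: val_inj.
apply: (@bob_wins_core dodeca K Q).
- by apply/fintype.subsetP => x; rewrite inE => /andP[].
- move=> v vK; have v0 : v.2 = ord0 by move: vK; rewrite inE => /eqP.
  pose s : seq dodeca := [:: (v.1, inord 1); (v.1, inord 2); (v.1, inord 3)].
  have Us : uniq s by rewrite /= !inE /= !xpair_eqE !eqxx /= -!val_eqE /= !inordK.
  rewrite -[3]/(size s) -(card_uniqP Us).
  apply/subset_leq_card/fintype.subsetP => u; rewrite /s !inE.
  case/or3P=> /eqP-> ; by rewrite /= /code_adj /= v0 /= eqxx -val_eqE /= !inordK.
- by move=> x u v xK /(privP x u xK)-> /(privP x v xK)->.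
- move=> v; rewrite inE => /andP[vK v20]; rewrite (cdegE v vK); apply/eqP.
  have H := all38 (fun v => if 20 <= v then sumn [seq (w \in core_nbrs v : nat) | w <- iota 0
    38] == 2 else true).
  by have := H _ v; rewrite v20; apply; vm_compute.
- move=> v vK; rewrite inE vK /= => v20; rewrite (cdegE v vK).
  have H := all38 (fun v => if 20 <= v then true else 2 < sumn [seq (w \in core_nbrs v : nat) |
    w <- iota 0 38]).
  by have := H _ v; rewrite (negPf v20); apply; vm_compute.
- move=> u v; rewrite inE => /andP[uK u20]; rewrite inE => /andP[vK v20].
  rewrite (adjK u v uK vK).
  have /allP/(_ (val v.1)) H := all38 (fun u => all (fun v => if (20 <= u) && (20 <= v) then v
    \notin core_nbrs u else true) (iota 0 38)) (erefl true) u.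
  by have := H _; rewrite u20 v20; apply; rewrite mem_iota; apply: (ltn_ord v.1).
- move=> v vK.
  rewrite (eq_bigr (fun u : dodeca => (val u.1 \in core_nbrs (val v.1)) : nat)); last first.
    by move=> u; rewrite inE => /andP[uK _]; rewrite (adjK v u vK uK).
  rewrite (eq_bigl (fun u => (u \in K) && (20 <= val u.1))); last by move=> u; rewrite inE.
  rewrite (sumK (fun w => 20 <= w) (fun w => (w \in core_nbrs (val v.1)) : nat)).
  have H := all38 (fun v => sumn [seq (if 20 <= w then w \in core_nbrs v : nat else 0) | w <-
    iota 0 38] <= 2).
  by apply: H; vm_compute.
(* With 38 core vertices, 18 of them subdividing, [many] holds with equality. *)
- have -> : K = [set x in K | xpredT (val x.1)] by apply/setP => x; rewrite !inE andbT.
  by rewrite (cardE (fun w => 20 <= w)) (cardE xpredT); vm_compute.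
Qed.

(** * The value of the game coloring number *)

Lemma alice_guaranteesW (G : sgraph) (s s' : nat) :
  s <= s' -> alice_guarantees G s -> alice_guarantees G s'.
Proof.
move=> ss' [sigma str win]; exists sigma => // p pp fp v.
exact: leq_trans (win p pp fp v) ss'.
Qed.

Lemma col_g_le (G : sgraph) (s : nat) : alice_guarantees G s -> col_g G <= s.
Proof. by move=> /asboolP Gs; rewrite /col_g; case: ex_minnP => m _; apply. Qed.

Lemma col_g_gt (G : sgraph) (s : nat) : ~ alice_guarantees G s -> s < col_g G.
Proof.
move=> nGs; rewrite /col_g; case: ex_minnP => m /asboolP Gm _.
by rewrite ltnNge; apply/negP => ms; apply/nGs/(alice_guaranteesW ms).
Qed.

Theorem corollary4 (R : realType) (k : nat) (hk : k = 7 \/ k = 8) :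
  max_col_g (@planar_girth R k) 5.
Proof.
have k7 : 7 <= k by case: hk => ->.
have k8 : k <= 8 by case: hk => ->.
have upper G : planar_girth R k G -> col_g G <= 5.
  case=> plG girth; apply/col_g_le/(planar_girth7_alice plG) => c /girth.
  exact: leq_trans.
(* Having girth at least 8, [dodeca] belongs to both families. *)
split=> //; exists dodeca; last first.
  apply/eqP; rewrite eqn_leq col_g_gt ?andbT; last exact: dodeca_bob.
  apply/col_g_le/(planar_girth7_alice (dodeca_planar R)) => c /dodeca_girth.
  exact: ltnW.
by split=> [|c /dodeca_girth]; [apply: dodeca_planar | apply: leq_trans].
Qed.
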